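(* The conjugacy class of a closed abelian subgroup $F$ of $G=\mathrm O(n)/\langle -I\rangle$ satisfying $\dim\mathfrak g_0^F=\dim F$ is determined by the integer $k=\frac12\mathrm{rank}(F/\ker m)$, the conjugacy class of the subgroup $B_F$, and the linear structure $(m,\mu_1,\dots,\mu_{s_0})$ on $F/\ker m$.
   Context: Let $G=\mathrm O(n)/\langle -I\rangle$ with Lie algebra $\mathfrak g_0$, and let $\pi:\mathrm O(n)\to G$ be the projection; $[A]=\pi(A)$. $\mathfrak g_0^F$ is the fixed space of $F$ under the adjoint action. For a closed abelian subgroup $F\subset G$, define $m:F\times F\to\{\pm1\}$ by $m([A],[B])=\lambda$ where $ABA^{-1}B^{-1}=\lambda I$; let $\ker m=\{x\in F:m(x,y)=1\ \forall y\in F\}$. Then $F/\ker m$ is an elementary abelian 2-group, i.e. an $\mathbb F_2$-vector space, to which $m$ descends; rank means its dimension. Let $B_F=\{x\in\ker m: A^2=I\ \forall A\in\pi^{-1}(x)\}$. Assume $\dim\mathfrak g_0^F=\dim F$. The group $\pi^{-1}(B_F)$ is diagonalizable; let $\mathbb R^n=V_1\oplus\cdots\oplus V_s$ be the decomposition into its distinct nonzero simultaneous eigenspaces, so that the centralizer of $\pi^{-1}(B_F)$ in $\mathrm O(n)$ is $\mathrm O(V_1)\times\cdots\times\mathrm O(V_s)$. With $k=\frac12\mathrm{rank}(F/\ker m)$, each $\dim V_i$ is $2^k$ or $2^{k+1}$; order them so that $\dim V_i=2^k$ for $1\le i\le s_0$ and $\dim V_i=2^{k+1}$ for $s_0<i\le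 s$. Every $A\in\pi^{-1}(F)$ preserves each $V_i$, and for $1\le i\le s_0$ one has $(A|_{V_i})^2=\mu_i([A])\,\mathrm{id}$ with $\mu_i([A])\in\{\pm1\}$; $\mu_i$ descends to a map $F/\ker m\to\{\pm1\}$ with $m(x,y)=\mu_i(x)\mu_i(y)\mu_i(xy)$. The linear structure $(m,\mu_1,\dots,\mu_{s_0})$ is considered as a multi-symplectic metric space, in which the order among the $\mu_i$ is overlooked: two such structures $(V,m,\mu_1,\dots,\mu_{s_0})$ and $(V',m',\mu_1',\dots,\mu_{s_0}')$ are isomorphic if there is a linear isomorphism $V\to V'$ transferring $(m,\mu_1,\dots,\mu_{s_0})$ to $(m',\mu'_{i_1},\dots,\mu'_{i_{s_0}})$ for some permutation $i_1,\dots,i_{s_0}$ of $1,\dots,s_0$.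
   Formalization: The permutation of the μ_i must be the one induced on the eigenspaces V_i by the element conjugating B_F to B_F'; with an arbitrary, unrelated permutation the claim is false (finite counterexample with n = 12, k = 1, six planes). *)

(* Defs.v *)
From HB Require Import structures.
From mathcomp Require Import all_boot all_order all_algebra.
From mathcomp Require Import all_classical all_reals all_analysis.

Set Implicit Arguments.
Unset Strict Implicit.
Unset Printing Implicit Defensive.

Import Order.TTheory GRing.Theory Num.Theory.
Import numFieldNormedType.Exports.

Local Open Scope classical_set_scope.
Local Open Scope ring_scope.
Local Open Scope quotient_scope.

Section OrthogonalGroup.
Variables (R : realType) (n : nat).

Record orthogonal_matrix := OrthogonalMatrix {
  omx :> 'M[R]_n;
  omxP : omx *m omx^T == 1%:M }.

HB.instance Definition _ := [isSub for omx].
HB.instance Definition _ := [Choice of orthogonal_matrix by <:].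

Lemma omulmxT (A : orthogonal_matrix) : omx A *m (omx A)^T = 1%:M.
Proof. exact/eqP/omxP. Qed.

Lemma otrmxM (A : orthogonal_matrix) : (omx A)^T *m omx A = 1%:M.
Proof. exact/mulmx1C/omulmxT. Qed.

Fact omul_subproof (A B : orthogonal_matrix) :
  (omx A *m omx B) *m (omx A *m omx B)^T == 1%:M.
Proof. by rewrite trmx_mul mulmxA -(mulmxA (omx A)) omulmxT mulmx1 omulmxT. Qed.

Fact oone_subproof : (1%:M : 'M[R]_n) *m (1%:M)^T == 1%:M.
Proof. by rewrite trmx1 mulmx1. Qed.

Fact oinv_subproof (A : orthogonal_matrix) :
  (omx A)^T *m (omx A)^T^T == 1%:M.
Proof. by rewrite trmxK otrmxM. Qed.

Fact oopp_subproof (A : orthogonal_matrix) :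
  (- omx A) *m (- omx A)^T == 1%:M.
Proof. by rewrite linearN mulmxN mulNmx opprK omulmxT. Qed.

Definition omul A B := OrthogonalMatrix (omul_subproof A B).
Definition oone := OrthogonalMatrix oone_subproof.
Definition oinv A := OrthogonalMatrix (oinv_subproof A).
Definition oopp A := OrthogonalMatrix (oopp_subproof A).

Fact omulA : associative omul.
Proof. by move=> A B C; apply: val_inj; rewrite /= mulmxA. Qed.
Fact omul1g : left_id oone omul.
Proof. by move=> A; apply: val_inj; rewrite /= mul1mx. Qed.
Fact omulg1 : right_id oone omul.
Proof. by move=> A; apply: val_inj; rewrite /= mulmx1. Qed.
Fact omulVg : left_inverse oone oinv omul.
Proof. by move=> A; apply: val_inj; rewrite /= otrmxM. Qed.
Fact omulgV : right_inverse oone oinv omul.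
Proof. by move=> A; apply: val_inj; rewrite /= omulmxT. Qed.

HB.instance Definition _ :=
  isGroup.Build orthogonal_matrix omulA omul1g omulg1 omulVg omulgV.

HB.instance Definition _ :=
  Topological.copy orthogonal_matrix (initial_topology omx).

Lemma omxM (A B : orthogonal_matrix) : omx (A * B)%g = omx A *m omx B.
Proof. by []. Qed.
Lemma omxV (A : orthogonal_matrix) : omx A^-1%g = (omx A)^T.
Proof. by []. Qed.
Lemma omx1 : omx 1%g = 1%:M. Proof. by []. Qed.

Definition opp_rel (A B : orthogonal_matrix) := (A == B) || (A == oopp B).

Lemma ooppK : involutive oopp.
Proof. by move=> A; apply: val_inj; rewrite /= opprK. Qed.

Fact opp_rel_is_equiv : equiv_class_of opp_rel.
Proof.
split=> [A|A B|B A C]; rewrite /opp_rel ?eqxx//.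
  by rewrite [B == A]eq_sym; congr (_ || _); rewrite -(inj_eq (inv_inj ooppK)) ooppK eq_sym.
by case/orP=> /eqP-> /orP[]/eqP->; rewrite ?ooppK ?eqxx ?orbT.
Qed.

Canonical opp_rel_equiv := EquivRelPack opp_rel_is_equiv.
Canonical opp_rel_encModRel := defaultEncModRel opp_rel.

Definition projO := {eq_quot opp_rel}.

HB.instance Definition _ : EqQuotient orthogonal_matrix opp_rel projO :=
  EqQuotient.on projO.
HB.instance Definition _ := Choice.on projO.

Definition piO (A : orthogonal_matrix) : projO := \pi_projO%qT A.

Lemma piO_eq A B : piO A = piO B <-> A = B \/ A = oopp B.
Proof.
rewrite /piO; split.
  move/eqmodP; rewrite /= /opp_rel => /orP[]/eqP; [by left|by right].
by move=> AB; apply/eqmodP; rewrite /= /opp_rel; case: AB => ->; rewrite eqxx ?orbT.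
Qed.

Lemma piO_repr (x : projO) : piO (repr x) = x.
Proof. exact: reprK. Qed.

Definition pone : projO := piO 1%g.
Definition pmul (x y : projO) : projO := piO (repr x * repr y)%g.
Definition pinv (x : projO) : projO := piO (repr x)^-1%g.

Lemma omulN A B : omul (oopp A) B = oopp (omul A B).
Proof. by apply: val_inj; rewrite /= mulNmx. Qed.
Lemma omulgN A B : omul A (oopp B) = oopp (omul A B).
Proof. by apply: val_inj; rewrite /= mulmxN. Qed.
Lemma ooppV A : oinv (oopp A) = oopp (oinv A).
Proof. by apply: val_inj; rewrite /= linearN. Qed.

Lemma pmulE A B : pmul (piO A) (piO B) = piO (A * B)%g.
Proof.
have /piO_eq hA := piO_repr (piO A).
have /piO_eq hB := piO_repr (piO B).
rewrite /pmul; apply/piO_eq.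
rewrite -[(repr _ * repr _)%g]/(omul (repr (piO A)) (repr (piO B))).
rewrite -[(A * B)%g]/(omul A B).
by case: hA => ->; case: hB => ->; rewrite ?(omulN, omulgN) ?ooppK;
  [left|right|right|left].
Qed.

Lemma pinvE A : pinv (piO A) = piO A^-1%g.
Proof.
have /piO_eq hA := piO_repr (piO A).
rewrite /pinv; apply/piO_eq.
rewrite -[(repr (piO A))^-1%g]/(oinv (repr (piO A))) -[A^-1%g]/(oinv A).
by case: hA => ->; rewrite ?ooppV; [left|right].
Qed.

Fact pmulA : associative pmul.
Proof.
move=> x y z; rewrite -[x]piO_repr -[y]piO_repr -[z]piO_repr.
by rewrite !pmulE mulgA.
Qed.
Fact pmul1g : left_id pone pmul.
Proof. by move=> x; rewrite -[x]piO_repr pmulE mul1g. Qed.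
Fact pmulg1 : right_id pone pmul.
Proof. by move=> x; rewrite -[x]piO_repr pmulE mulg1. Qed.
Fact pmulVg : left_inverse pone pinv pmul.
Proof. by move=> x; rewrite -[x]piO_repr pinvE pmulE mulVg. Qed.
Fact pmulgV : right_inverse pone pinv pmul.
Proof. by move=> x; rewrite -[x]piO_repr pinvE pmulE mulgV. Qed.

HB.instance Definition _ :=
  isGroup.Build projO pmulA pmul1g pmulg1 pmulVg pmulgV.

Definition popen (U : set projO) : Prop := open (piO @^-1` U).

Fact popenT : popen setT.
Proof. by rewrite /popen preimage_setT; exact: openT. Qed.
Fact popenI : setI_closed popen.
Proof. by move=> U U' oU oU'; rewrite /popen preimage_setI; exact: openI. Qed.
Fact popen_bigU (I : Type) (f : I -> set projO) :
  (forall i, popen (f i)) -> popen (\bigcup_i f i).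
Proof.
by move=> of_; rewrite /popen preimage_bigcup; apply: bigcup_open => i _; exact: of_.
Qed.

HB.instance Definition _ :=
  isOpenTopological.Build projO popenT popenI popen_bigU.

Lemma piOM A B : piO (A * B)%g = (piO A * piO B)%g.
Proof. by rewrite [RHS]pmulE. Qed.
Lemma piOV A : piO A^-1%g = (piO A)^-1%g.
Proof. by rewrite [RHS]pinvE. Qed.
Lemma piO1 : piO 1%g = 1%g. Proof. by []. Qed.

End OrthogonalGroup.


Section LieAlgebra.
Variables (R : realType) (n : nat).
Local Notation G := (projO R n).

Definition expmx (X : 'M[R]_n) : 'M[R]_n :=
  limn (series (fun k => (k`!%:R)^-1 *: X ^+ k)).

(* The Lie algebra of O(n), identified with that of O(n)/<-I> through the
   covering piO; its exponential map is then X |-> piO (expmx X). *)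
Definition so : set 'M[R]_n := [set X | X^T = - X].

Definition Ad (A : orthogonal_matrix R n) (X : 'M[R]_n) : 'M[R]_n :=
  omx A *m X *m omx A^-1%g.

Lemma Ad_opp A X : Ad (oopp A) X = Ad A X.
Proof. by rewrite /Ad !omxV /= linearN mulmxN !mulNmx opprK. Qed.

Definition lie_fixed (F : set G) : set 'M[R]_n :=
  [set X | so X /\ forall A, F (piO A) -> Ad A X = X].

(* Lie algebra of a closed subgroup F of O(n)/<-I>: the directions of the
   one-parameter subgroups contained in F. *)
Definition lie (F : set G) : set 'M[R]_n :=
  [set X | so X /\
           forall t : R, exists2 A, omx A = expmx (t *: X) & F (piO A)].

End LieAlgebra.

Definition subspace_dim (K : fieldType) (V : vectType K) (S : set V) (d : nat) :=
  exists U : {vspace V}, (forall x, x \in U <-> S x) /\ \dim U = d.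

Definition lmod_dim (K : fieldType) (V : lmodType K) (d : nat) :=
  exists f : {linear V -> 'rV[K]_d}, bijective f.

Record closed_abelian (R : realType) (n : nat) := ClosedAbelian {
  ca_set :> set (projO R n);
  ca_1 : ca_set 1%g;
  ca_M : forall x y, ca_set x -> ca_set y -> ca_set (x * y)%g;
  ca_V : forall x, ca_set x -> ca_set x^-1%g;
  ca_C : forall x y, ca_set x -> ca_set y -> (x * y = y * x)%g;
  ca_closed : closed ca_set }.

Section CommutatorForm.
Variables (R : realType) (n : nat).
Local Notation G := (projO R n).

(* For commuting x = [A] and y = [B] the commutator of A and B is I or -I; see
   mE below, which also shows that the choice of representatives is immaterial. *)
Definition m (x y : G) : R :=
  let A := repr x in let B := repr y in
  if (A * B * A^-1 * B^-1)%g == 1%g then 1 else -1.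

Lemma commP (x y : G) (A B : orthogonal_matrix R n) :
  piO A = x -> piO B = y -> (x * y = y * x)%g ->
  (A * B)%g = (B * A)%g \/ (A * B)%g = oopp (B * A)%g.
Proof. by move=> <- <-; rewrite -!piOM => /piO_eq. Qed.

Lemma comm1P (A B : orthogonal_matrix R n) :
  (A * B * A^-1 * B^-1)%g = 1%g <-> (A * B)%g = (B * A)%g.
Proof.
split=> [h|->]; last by rewrite mulgK mulgV.
by rewrite -[RHS]mul1g -h -!mulgA mulKg mulVg mulg1.
Qed.

Lemma mul_oopp (A B : orthogonal_matrix R n) :
  ((oopp A * B)%g = oopp (A * B)%g) * ((A * oopp B)%g = oopp (A * B)%g).
Proof. by split; [exact: omulN|exact: omulgN]. Qed.

Lemma m1P (x y : G) (A B : orthogonal_matrix R n) :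
  piO A = x -> piO B = y -> m x y = 1 <-> (A * B)%g = (B * A)%g.
Proof.
move=> Ax By; rewrite /m.
have e : (A * B)%g = (B * A)%g <-> (repr x * repr y)%g = (repr y * repr x)%g.
  have /piO_eq := etrans Ax (esym (piO_repr x)).
  have /piO_eq := etrans By (esym (piO_repr y)).
  by do 2![case=> ->]; rewrite ?mul_oopp ?ooppK//; split=> [/(inv_inj (@ooppK R n))|->].
rewrite e -comm1P; split=> [|->]; last by rewrite eqxx.
case: ifPn => [/eqP//|_ /eqP].
by rewrite eq_sym -addr_eq0 -mulr2n pnatr_eq0.
Qed.

Lemma mE (x y : G) (A B : orthogonal_matrix R n) :
  (x * y = y * x)%g -> piO A = x -> piO B = y ->
  omx (A * B * A^-1 * B^-1)%g = (m x y)%:M.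
Proof.
move=> xy Ax By; have [AB|AB] := commP Ax By xy.
  by have/(m1P Ax By) -> := AB; rewrite AB mulgK mulgV.
have [BA|BA] := pselect ((A * B)%g = (B * A)%g).
  by have/(m1P Ax By) -> := BA; rewrite BA mulgK mulgV.
have -> : m x y = -1.
  by have := contra_not (m1P Ax By).1 BA; rewrite /m; case: eqP.
rewrite AB -!mul_oopp mulgK mul_oopp mulgV /=.
by rewrite -scaleN1r scale_scalar_mx mulr1.
Qed.

Definition ker_m (F : set G) : set G :=
  [set x | F x /\ forall y, F y -> m x y = 1].

Definition BF (F : set G) : set G :=
  [set x | ker_m F x /\ forall A, piO A = x -> (A * A)%g = 1%g].

End CommutatorForm.

Section Quotient.
Variables (R : realType) (n : nat) (F : closed_abelian R n).
Local Notation G := (projO R n).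

(* F written additively *)
Definition elt : Type := {x : G | x \in (F : set G)}.
HB.instance Definition _ := [isSub of elt for @sval G _].
HB.instance Definition _ := [Choice of elt by <:].

Lemma eltP (x : elt) : ca_set F (val x). Proof. exact/set_mem/(valP x). Qed.
Definition mkelt (x : G) (Fx : ca_set F x) : elt := Sub x (mem_set Fx).

Definition elt0 : elt := mkelt (ca_1 F).
Definition eltD (x y : elt) : elt := mkelt (ca_M (eltP x) (eltP y)).
Definition eltN (x : elt) : elt := mkelt (ca_V (eltP x)).

Fact eltDA : associative eltD.
Proof. by move=> x y z; apply: val_inj; rewrite /= mulgA. Qed.
Fact eltDC : commutative eltD.
Proof. by move=> x y; apply: val_inj; exact: (ca_C (eltP x) (eltP y)). Qed.
Fact elt0D : left_id elt0 eltD.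
Proof. by move=> x; apply: val_inj; rewrite /= mul1g. Qed.
Fact eltND : left_inverse elt0 eltN eltD.
Proof. by move=> x; apply: val_inj; rewrite /= mulVg. Qed.

HB.instance Definition _ := GRing.isZmodule.Build elt eltDA eltDC elt0D eltND.

Definition kerP : {pred elt} := fun x => `[< ker_m F (val x) >].

Lemma kerPE (x : elt) : x \in kerP <->
  forall (A B : orthogonal_matrix R n), piO A = val x -> ca_set F (piO B) -> (A * B)%g = (B * A)%g.
Proof.
split.
  by move=> /asboolP [_ h] A B Ax FB; exact/(m1P Ax (erefl _))/h.
move=> h; apply/asboolP; split; first exact: eltP.
move=> y Fy; apply/(m1P (piO_repr _) (piO_repr y))/h; rewrite ?piO_repr//.
Qed.

Fact kerP_zmod_closed : zmod_closed kerP.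
Proof.
split=> [|x y /kerPE kx /kerPE ky]; apply/kerPE => A B.
  by move=> /piO_eq[]-> _; rewrite ?mul_oopp mul1g mulg1.
move=> Axy FB.
have : piO A = piO (repr (val x) * (repr (val y))^-1)%g.
  by rewrite Axy piOM piOV !piO_repr.
have cx := kx _ B (piO_repr _) FB; have cy := ky _ B (piO_repr _) FB.
have cyV : ((repr (val y))^-1 * B = B * (repr (val y))^-1)%g.
  by apply: (mulgI (repr (val y))); rewrite !mulgA mulgV mul1g cy mulgK.
have cxy : (repr (val x) * (repr (val y))^-1 * B =
            B * (repr (val x) * (repr (val y))^-1))%g.
  by rewrite -mulgA cyV mulgA cx mulgA.
by move=> /piO_eq[]->; rewrite ?mul_oopp cxy.
Qed.

HB.instance Definition _ := GRing.isZmodClosed.Build elt kerP kerP_zmod_closed.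

Definition quo : Type := Quotient.quot kerP.
HB.instance Definition _ := GRing.Zmodule.on quo.

Definition to_quo (x : elt) : quo := \pi_(Quotient.quot kerP) x.
Definition quo_repr (u : quo) : elt := repr (u : Quotient.quot kerP).

Lemma quo_reprK (u : quo) : to_quo (quo_repr u) = u.
Proof. exact: reprK. Qed.

Lemma to_quo_eq (x y : elt) : to_quo x = to_quo y <-> x - y \in kerP.
Proof.
by rewrite Quotient.idealrBE; split=> [|/eqP//] h; apply/eqP.
Qed.

Lemma to_quoD x y : to_quo (x + y) = to_quo x + to_quo y.
Proof. exact: (raddfD (\pi_(Quotient.quot kerP))). Qed.

Lemma to_quo0 : to_quo 0 = 0.
Proof. exact: (raddf0 (\pi_(Quotient.quot kerP))). Qed.

Lemma quo2 (u : quo) : u *+ 2 = 0.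
Proof.
rewrite -[u]quo_reprK mulr2n -to_quoD.
rewrite -to_quo0; apply/to_quo_eq; rewrite subr0; apply/kerPE => A B.
set x := quo_repr u; move=> Ax FB.
have : piO A = piO (repr (val x) * repr (val x))%g.
  by rewrite Ax piOM !piO_repr.
suff c : ((repr (val x) * repr (val x)) * B = B * (repr (val x) * repr (val x)))%g.
  by move=> /piO_eq[]->; rewrite ?mul_oopp c.
have := commP (piO_repr (val x)) (erefl (piO B)) (ca_C (eltP x) FB).
by case=> e; rewrite -mulgA e ?mul_oopp !mulgA e ?mul_oopp ?ooppK.
Qed.

Definition quo_scale (a : 'F_2) (u : quo) : quo := u *+ a.

Lemma quo_mod2 (u : quo) k : u *+ (k %% 2) = u *+ k.
Proof. by rewrite [in RHS](divn_eq k 2) mulrnDr mulnC mulrnA quo2 mul0rn add0r. Qed.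

Fact quo_scaleA a b u : quo_scale a (quo_scale b u) = quo_scale (a * b) u.
Proof. by rewrite /quo_scale -mulrnA [in RHS]/= quo_mod2 mulnC. Qed.
Fact quo_scale1 : left_id 1 quo_scale. Proof. by []. Qed.
Fact quo_scaleDr : right_distributive quo_scale +%R.
Proof. by move=> a u v; rewrite /quo_scale mulrnDl. Qed.
Fact quo_scaleDl u : {morph quo_scale^~ u : a b / a + b}.
Proof. by move=> a b; rewrite /quo_scale -mulrnDr [in LHS]/= quo_mod2. Qed.

HB.instance Definition _ := GRing.Zmodule_isLmodule.Build 'F_2 quo
  quo_scaleA quo_scale1 quo_scaleDr quo_scaleDl.

End Quotient.

Section DescendedForms.
Variables (R : realType) (n : nat).

Definition mbar (F : closed_abelian R n) (u v : quo F) : R :=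
  m (val (quo_repr u)) (val (quo_repr v)).

Lemma m_sign (x y : projO R n) : m x y = 1 \/ m x y = -1.
Proof. by rewrite /m; case: ifP; [left|right]. Qed.

Lemma m_eq (x y x' y' : projO R n) :
  (m x y = 1 <-> m x' y' = 1) -> m x y = m x' y'.
Proof.
have [->|->] := m_sign x y; have [->|->] := m_sign x' y' => //.
  by case=> /(_ erefl) ->.
by case=> _ /(_ erefl) ->.
Qed.

Lemma mC (x y : projO R n) : m x y = m y x.
Proof.
apply: m_eq; rewrite (m1P (piO_repr x) (piO_repr y)).
by rewrite (m1P (piO_repr y) (piO_repr x)); split=> ->.
Qed.

Lemma m_to_quo (F : closed_abelian R n) (x x' y : elt F) :
  to_quo x = to_quo x' -> m (val x) (val y) = m (val x') (val y).
Proof.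
move=> /to_quo_eq /kerPE k; apply: m_eq.
have hA : piO (repr (val x) * (repr (val x'))^-1)%g = val (x - x').
  by rewrite piOM piOV !piO_repr.
have := k _ (repr (val y)) hA; rewrite piO_repr => /(_ (eltP y)) c.
rewrite (m1P (piO_repr _) (piO_repr _)) (m1P (piO_repr _) (piO_repr _)).
set a := repr (val x) in c *; set a' := repr (val x') in c *.
set b := repr (val y) in c *.
have -> : a = ((a * a'^-1) * a')%g by rewrite mulgVK.
split=> e.
  by apply: (mulgI (a * a'^-1)%g); rewrite [LHS]mulgA e [RHS]mulgA c mulgA.
by rewrite -[LHS]mulgA e [LHS]mulgA c -[LHS]mulgA.
Qed.

Lemma mbarE (F : closed_abelian R n) (x y : elt F) :
  mbar (to_quo x) (to_quo y) = m (val x) (val y).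
Proof.
rewrite /mbar (m_to_quo _ (quo_reprK (to_quo x))) mC.
by rewrite (m_to_quo _ (quo_reprK (to_quo y))) mC.
Qed.

(* If the square of A acts on V by a sign, mu V [A] is this sign (see muE). *)
Definition mu (V : {vspace 'cV[R]_n}) (x : projO R n) : R :=
  let A := repr x in
  if `[< forall v, v \in V -> omx A *m (omx A *m v) = v >] then 1 else -1.

Lemma muE (V : {vspace 'cV[R]_n}) (x : projO R n) (A : orthogonal_matrix R n) (e : R) :
  V != 0%VS -> (e = 1 \/ e = -1) -> piO A = x ->
  (forall v, v \in V -> omx A *m (omx A *m v) = e *: v) -> mu V x = e.
Proof.
move=> V0 e1 Ax AV; have AVr v : v \in V ->
    omx (repr x) *m (omx (repr x) *m v) = e *: v.
  move=> /AV; have /piO_eq := etrans Ax (esym (piO_repr x)).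
  by case=> -> //=; rewrite !mulNmx mulmxN opprK.
rewrite /mu; case: asboolP => [h|h]; case: e1 => e1; rewrite e1//.
  have := AVr _ (memv_pick V); rewrite h ?memv_pick// e1 scaleN1r => /eqP.
  rewrite -addr_eq0 -mulr2n -scaler_nat scaler_eq0 pnatr_eq0/= vpick0.
  by rewrite (negPf V0).
by exfalso; apply: h => v /AVr ->; rewrite e1 scale1r.
Qed.

End DescendedForms.

(* A multi-symplectic metric space (car, form, quads 1, ..., quads s0). *)
Record multi_metric (R : realType) := MultiMetric {
  mm_size : nat;
  mm_car : lmodType 'F_2;
  mm_form : mm_car -> mm_car -> R;
  mm_quad : 'I_mm_size -> mm_car -> R }.

(* S and S' are isomorphic as multi-symplectic metric spaces when this holds
   for some sigma.  The permutation is kept explicit because the i-th quadratic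
   form of F lives on the i-th eigenspace of BF F: when BF F and BF F' are
   identified by a conjugation, sigma has to be the induced matching of the
   eigenspaces.  With unrelated matchings the data do not determine F: for
   n = 12 and k = 1, take for the preimage of BF F the group C <= {1,-1}^6 of
   signs on six planes having an even number of -1 on the first four planes,
   and for the preimage of F (resp. F') the group generated by C, A1 and A2,
   where A1 is the rotation by pi/2 on planes 1, 2 (resp. 5, 6) and the swap of
   the two coordinates on the other planes, and A2 is diag(1,-1) on each plane.
   Then BF F = BF F', and (m, mu_1, .., mu_6) agree up to the order of the mu_i,
   but no symmetry of C takes planes {1, 2} to {5, 6}, so F and F' are not
   conjugate. *)
Definition mm_iso_along (R : realType) (S S' : multi_metric R)
    (sigma : 'I_(mm_size S) -> 'I_(mm_size S')) : Prop :=
  bijective sigma /\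
  exists phi : {linear mm_car S -> mm_car S'},
    [/\ bijective phi,
        forall u v, mm_form (phi u) (phi v) = mm_form u v &
        forall i u, mm_quad (sigma i) (phi u) = mm_quad i u].

Section Eigenspaces.
Variables (R : realType) (n : nat).

Definition sim_eigenspace (S : set (orthogonal_matrix R n)) (V : {vspace 'cV[R]_n}) :=
  V != 0%VS /\
  exists chi : orthogonal_matrix R n -> R,
    forall v, v \in V <-> (forall A, S A -> omx A *m v = chi A *: v).

Record eigen_ordering (F : set (projO R n)) (k : nat) := EigenOrdering {
  eo_s : nat;
  eo_s0 : nat;
  eo_le : (eo_s0 <= eo_s)%N;
  eo_V : 'I_eo_s -> {vspace 'cV[R]_n};
  eo_inj : injective eo_V;
  eo_enum : forall W : {vspace 'cV[R]_n},
    sim_eigenspace (@piO R n @^-1` BF F) W <-> exists i, eo_V i = W;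
  eo_dim1 : forall i : 'I_eo_s, (i < eo_s0)%N -> \dim (eo_V i) = (2 ^ k)%N;
  eo_dim2 : forall i : 'I_eo_s, (eo_s0 <= i)%N -> \dim (eo_V i) = (2 ^ k.+1)%N }.

(* V_1, ..., V_(s0) *)
Definition eo_W (F : set (projO R n)) k (D : eigen_ordering F k)
    (i : 'I_(eo_s0 D)) : {vspace 'cV[R]_n} :=
  eo_V (widen_ord (eo_le D) i).

(* When dim g_0^F = dim F, mu (eo_W i) x depends only on the class of x modulo
   ker m, so that evaluating it at a representative is harmless. *)
Definition linear_structure (F : closed_abelian R n) k (D : eigen_ordering F k) :
    multi_metric R :=
  {| mm_size := eo_s0 D;
     mm_car := quo F;
     mm_form := @mbar R n F;
     mm_quad := fun i u => mu (eo_W i) (val (quo_repr u)) |}.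

Definition conjs (g : projO R n) (F : set (projO R n)) : set (projO R n) :=
  [set (g * x * g^-1)%g | x in F].

Definition omove (A : orthogonal_matrix R n) (V : {vspace 'cV[R]_n}) : {vspace 'cV[R]_n} :=
  (linfun (mulmx (omx A)) @: V)%VS.

End Eigenspaces.

(* Main.v *)
Require Import Defs.
From HB Require Import structures.
From mathcomp Require Import all_boot all_order all_algebra.
From mathcomp Require Import all_classical all_reals all_analysis.
From mathcomp Require Import complex ring lra.
Import Order.TTheory GRing.Theory Num.Theory.
Import numFieldNormedType.Exports.

(** Let G be the preimage of F in O(n), a group in which any two elements commute up to
    sign; its centre Z is the preimage of ker m, and the preimage B of B_F is the
    set of involutions of Z (saturated, preimage_centre,
    preimage_involutive_centre).  Let R^n be the orthogonal sum of the simultaneous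
    eigenspaces V_i of B, with projections P_i (eigenprojections).

    The hypothesis dim g_0^F = dim F says that every skew X commuting with G
    satisfies exp (t X) in G for all t; these exponentials are then central
    (saturated_preimage).  Consequently the skew matrices commuting with G form,
    on each V_i, either 0 or a line spanned by some J_i with J_i^2 = - P_i: the
    spectral projections of X^2 produce rotations by pi, which are elements of B
    and hence scalar on V_i (skew_block_line).  Call V_i real in the first case
    and complex in the second.  The centre contains all phases exp (r J_i), so
    that Z is the product of B with the torus of these phases, and it acts on real
    blocks by signs (exists_phases, centre_block).  Averaging over G / Z, which is
    the space F / ker m with 4^k elements, shows that the commutant of G on V_i is
    spanned by P_i and J_i, and that (dim V_i)^2 is 4^k for a real block and
    4^(k+1) for a complex one (real_block_scalar, block_trace_sqr).  Hence the
    real blocks are V_1, .., V_(s0).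

    Now take F and F', and conjugate F' so that B_F = B_F'.  The dimensions of
    the blocks show that F and F' have the same real blocks.  Lift a basis of
    F / ker m to x_b in G, and its image under the given isomorphism of linear
    structures to x'_b in G'.  The forms m say that the x_b and the x'_b satisfy
    the same commutation relations; their squares on a real block are the signs
    mu_i, hence equal, and on complex blocks the squares can be normalized to 1 by
    phases (exists_unit_square).  On each block the operators
    X |-> x'_b X x_b^T are then commuting involutions.  A common eigenvector
    intertwines the x_b with the x'_b up to signs, and the signs can be corrected
    by an element of G because m is nondegenerate on F / ker m (separating_of_card,
    exists_intertwiner).  As the commutants are known, Schur's argument makes the
    intertwiner an isometry of V_i (exists_block_isometry).  The sum of these
    isometries conjugates each x_b to x'_b, fixes B and matches the phases, so it
    conjugates G onto G' (conj_incl, conj_of_matching). *)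

Set Implicit Arguments.
Unset Strict Implicit.
Unset Printing Implicit Defensive.

Local Open Scope classical_set_scope.
Local Open Scope ring_scope.

(** * Real linear algebra *)

Section LinearAlgebra.
Variables (R : realType) (n : nat).
Implicit Types X Y S Q g h : 'M[R]_n.

Lemma trmxZ p q a (X : 'M[R]_(p, q)) : (a *: X)^T = a *: X^T.
Proof. by apply/matrixP => i j; rewrite !mxE. Qed.

Lemma mulmx_col m p (A : 'M[R]_(m, n)) (B : 'M[R]_(n, p)) j :
  A *m col j B = col j (A *m B).
Proof. by rewrite !colE mulmxA. Qed.

Lemma mxtr_sqr_ge0 m p (A : 'M[R]_(m, p)) : 0 <= \tr (A^T *m A).
Proof.
rewrite /mxtrace; apply: sumr_ge0 => i _; rewrite mxE; apply: sumr_ge0 => j _.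
by rewrite mxE -expr2 sqr_ge0.
Qed.

Lemma mxtr_sqr_eq0 m p (A : 'M[R]_(m, p)) : \tr (A^T *m A) = 0 -> A = 0.
Proof.
rewrite /mxtrace => /eqP; rewrite psumr_eq0 => [/allP H|i _]; last first.
  by rewrite mxE; apply: sumr_ge0 => j _; rewrite mxE -expr2 sqr_ge0.
apply/matrixP => i j; have := H j (mem_index_enum _).
rewrite /= mxE psumr_eq0 => [/allP H2|l _]; last by rewrite mxE -expr2 sqr_ge0.
by have := H2 i (mem_index_enum _); rewrite /= mxE mulf_eq0 orbb mxE => /eqP.
Qed.

Lemma mxtr_gt0 S : S^T = S -> S *m S = S -> S != 0 -> 0 < \tr S.
Proof.
move=> St SS S0; rewrite -SS -{1}St lt_def mxtr_sqr_ge0 andbT.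
by apply: contra_neqN S0 => /eqP; exact: mxtr_sqr_eq0.
Qed.

(** In finite dimension a maximal subspace inside a linear predicate exhausts it,
    so conditions quantified over infinite groups still cut out a subspace. *)
Lemma linear_pred_vspace (V : vectType R) (p : V -> Prop) :
  p 0 -> (forall a u v, p u -> p v -> p (a *: u + v)) ->
  exists U : {vspace V}, forall v, v \in U <-> p v.
Proof.
move=> p0 plin.
pose Q d := `[< exists U : {vspace V}, \dim U = d /\ forall v, v \in U -> p v >].
have exQ : exists d, Q d.
  exists 0%N; apply/asboolP; exists 0%VS; rewrite dimv0; split=> // v.
  by rewrite memv0 => /eqP ->.
have ubQ d : Q d -> (d <= \dim {:V})%N.
  by move=> /asboolP[U [<- _]]; rewrite dimvS// subvf.
have [d /asboolP[U [dU Up]] maxd] := ex_maxnP exQ ubQ.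
exists U => v; split=> [/Up//|pv].
have : (\dim (U + <[v]>)%VS <= \dim U)%N.
  rewrite dU; apply: maxd; apply/asboolP; exists (U + <[v]>)%VS; split=> // w.
  move=> /memv_addP[u uU [x /vlineP[a ->] ->]]; rewrite addrC; exact: plin (Up _ uU).
rewrite (geq_leqif (dimv_leqif_sup (addvSl U <[v]>%VS))) => /subvP/(_ v); apply.
by apply/memv_addP; exists 0; [exact: mem0v|exists v; rewrite ?memv_line ?add0r].
Qed.

(** Gram-Schmidt: while the d columns of Q do not span U, some vector of U minus
    its projection Q Q^T u gives, after normalization, one more column. *)
Lemma orthonormal_frame (U : {vspace 'cV[R]_n}) d : (d <= \dim U)%N ->
  exists2 Q : 'M[R]_(n, d), Q^T *m Q = 1%:M & forall w, Q *m w \in U.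
Proof.
elim: d => [_|d IH dU].
  exists 0; first by apply/matrixP => -[].
  by move=> w; rewrite mul0mx mem0v.
have [Q QQ QU] := IH (ltnW dU).
have [u uU Qu] : exists2 u, u \in U & Q *m (Q^T *m u) != u.
  apply/not_exists2P => H; have : (\dim U <= d)%N; last by rewrite leqNgt dU.
  have -> : U = (linfun (mulmx Q) @: fullv)%VS :> {vspace 'cV[R]_n}.
    apply/vspaceP => w; apply/idP/idP => [wU|/memv_imgP[y _ ->]]; last by rewrite lfunE/= QU.
    apply/memv_imgP; exists (Q^T *m w); rewrite ?memvf// lfunE/=.
    by have [//|/negP/negPn/eqP ->] := H w.
  apply: leq_trans (_ : \dim {:'cV[R]_d} <= _)%N; last by rewrite dimvf /dim/= muln1.
  by rewrite -[X in (_ <= X)%N](limg_ker_dim (linfun (mulmx Q)) fullv) leq_addl.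
pose w := u - Q *m (Q^T *m u).
have wU : w \in U by rewrite memvB.
have Qw : Q^T *m w = 0 by rewrite mulmxBr !mulmxA QQ mul1mx subrr.
have w0 : w != 0 by rewrite subr_eq0 eq_sym.
pose r := (w^T *m w) 0 0.
have r0 : 0 < r.
  rewrite lt_def; apply/andP; split.
    apply: contraNneq w0 => r0; apply/eqP/mxtr_sqr_eq0; by rewrite /mxtrace big_ord1.
  by have := mxtr_sqr_ge0 w; rewrite /mxtrace big_ord1.
pose q := (Num.sqrt r)^-1 *: w.
have qq : q^T *m q = 1%:M.
  rewrite trmxZ -scalemxAl -scalemxAr scalerA -invfM -expr2 sqr_sqrtr ?ltW//.
  by apply/matrixP => i j; rewrite !ord1 [LHS]mxE mulVf ?gt_eqF// mxE.
have Qq : Q^T *m q = 0 by rewrite -scalemxAr Qw scaler0.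
have E : (row_mx q Q)^T *m row_mx q Q = 1%:M.
  rewrite tr_row_mx mul_col_row qq QQ Qq -[q^T *m Q]trmxK trmx_mul trmxK Qq trmx0.
  by rewrite -scalar_mx_block.
have EU (v : 'cV_(1 + d)) : row_mx q Q *m v \in U.
  rewrite -[v]vsubmxK mul_row_col memvD//.
  by rewrite (mx11_scalar (usubmx _)) mul_mx_scalar memvZ// memvZ.
by exists (row_mx q Q : 'M[R]_(n, 1 + d)); [exact: E|exact: EU].
Qed.

Lemma orthogonal_projection (U : {vspace 'cV[R]_n}) : exists Q : 'M[R]_n,
  [/\ Q^T = Q, Q *m Q = Q, forall w, w \in U <-> Q *m w = w & \tr Q = (\dim U)%:R].
Proof.
have [Q QQ QU] := orthonormal_frame (leqnn (\dim U)).
exists (Q *m Q^T); split.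
- by rewrite trmx_mul trmxK.
- by rewrite mulmxA -(mulmxA Q) QQ mulmx1.
- have UE : (linfun (mulmx Q) @: fullv)%VS = U.
    apply/eqP; rewrite eqEdim; apply/andP; split.
      by apply/subvP => v /memv_imgP[y _ ->]; rewrite lfunE/=.
    rewrite limg_dim_eq ?dimvf /dim/= ?muln1//.
    apply/eqP; rewrite -subv0; apply/subvP => v.
    rewrite memv_cap memv_ker lfunE/= memv0 => /andP[_ /eqP Qv].
    by rewrite -[v]mul1mx -QQ -mulmxA Qv mulmx0.
  move=> w; split=> [wU|<-]; last by rewrite -mulmxA.
  have : w \in (linfun (mulmx Q) @: fullv)%VS by rewrite UE.
  by move=> /memv_imgP[y _ ->]; rewrite lfunE/= -mulmxA (mulmxA Q^T) QQ mul1mx.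
- by rewrite mxtrace_mulC QQ mxtrace1.
Qed.

(** The image of Q is stable under g and under its transpose, hence so is its
    orthogonal complement; this is why Q and g commute. *)
Lemma projection_commutes Q g : Q^T = Q -> g *m Q = Q *m g *m Q ->
  g^T *m Q = Q *m g^T *m Q -> g *m Q = Q *m g.
Proof.
move=> Qt gQ /(congr1 trmx); rewrite !trmx_mul trmxK Qt => H.
by rewrite gQ -mulmxA -H.
Qed.

(** Over R[i] the matrix is Hermitian, hence diagonalizable with real eigenvalues,
    one of which is nonzero; a real eigenvalue has a real eigenvector. *)
Lemma symmetric_eigenvalue S : S^T = S -> S != 0 ->
  exists l, l != 0 /\ exists2 v : 'rV[R]_n, v != 0 & v *m S = l *: v.
Proof.
move=> St S0; set SC := map_mx (real_complex R) S.
have Ssym : SC \is symmetricmx.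
  apply/is_hermitianmxP; rewrite expr0 scale1r; apply/matrixP => i j.
  by rewrite !mxE /= -{1}St mxE.
have Sreal : SC \is a realmx.
  by apply/mxOverP => i j; rewrite mxE complex_real.
have herm := realsym_hermsym Ssym Sreal.
have /orthomx_spectralP Sdiag := hermitian_normalmx herm.
have unitP := spectral_unit SC.
have [i di] : exists i, spectral_diag SC 0 i != 0.
  apply: contrapT => H; move/negP: S0; apply.
  rewrite -(map_mx_eq0 (real_complex R)) -/SC Sdiag.
  have -> : spectral_diag SC = 0.
    apply/rowP => j; rewrite mxE; apply/eqP/negPn/negP => dj; apply: H.
    by exists j.
  by rewrite (_ : diag_mx 0 = 0) ?mulmx0 ?mul0mx//; apply/matrixP => p q; rewrite !mxE mul0rn.
have /mxOverP/(_ 0 i)/complex_realP[l dl] := hermitian_spectral_diag_real herm.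
have : eigenvalue SC (real_complex R l).
  apply/eigenvalueP; exists (row i (spectralmx SC)).
    rewrite -dl -row_mul {2}Sdiag !mulmxA mulmxV// mul1mx row_mul.
    rewrite row_diag_mx -scalemxAl -rowE //.
  apply: contraTneq unitP => r0; apply/negP => /mulmxV/(congr1 (row i)).
  by rewrite row_mul r0 mul0mx => /rowP/(_ i); rewrite !mxE eqxx => /esym/eqP; rewrite oner_eq0.
rewrite eigenvalue_map => /eigenvalueP[v vS v0]; exists l; split; last by exists v.
by apply: contra_neq di => l0; rewrite dl l0 rmorph0.
Qed.
End LinearAlgebra.

(** * Saturated groups and their commutants *)

Section Saturated.
Variables (R : realType) (n : nat).
Implicit Types (X Y S Q P J g h z : 'M[R]_n).

Definition commutant (G : set 'M[R]_n) : set 'M[R]_n :=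
  [set X | forall g, G g -> g *m X = X *m g].

Definition centre (G : set 'M[R]_n) : set 'M[R]_n := G `&` commutant G.

Definition involutive_centre (G : set 'M[R]_n) : set 'M[R]_n :=
  [set b | centre G b /\ b *m b = 1%:M].

(** These are the properties of the preimage in O(n) of a closed abelian subgroup
    F of O(n)/<-I> with dim g_0^F = dim F that the proof uses.  When J^3 = - J,
    the matrix in sat_rot is exp (r J) for (c, s) = (cos r, sin r): a skew
    matrix commuting with G generates a one-parameter group inside G.  Such a
    one-parameter group is central, which after differentiation is
    sat_central. *)
Record saturated (G : set 'M[R]_n) : Prop := Saturated {
  sat_orth : forall g, G g -> g *m g^T = 1%:M;
  sat_1 : G 1%:M;
  sat_M : forall g h, G g -> G h -> G (g *m h);
  sat_tr : forall g, G g -> G g^T;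
  sat_comm : forall g h, G g -> G h -> g *m h = h *m g \/ g *m h = - (h *m g);
  sat_rot : forall J, J^T = - J -> commutant G J -> J *m J *m J = - J ->
    forall c s, c ^+ 2 + s ^+ 2 = 1 -> G (1%:M + s *: J + (1 - c) *: (J *m J));
  sat_central : forall X Y, X^T = - X -> commutant G X -> commutant G Y ->
    X *m Y = Y *m X }.

Section Commutant.
Variables (G : set 'M[R]_n).

Lemma commutantM X Y : commutant G X -> commutant G Y -> commutant G (X *m Y).
Proof. by move=> cX cY g Gg; rewrite mulmxA cX// -mulmxA cY// mulmxA. Qed.
Lemma commutantD X Y : commutant G X -> commutant G Y -> commutant G (X + Y).
Proof. by move=> cX cY g Gg; rewrite mulmxDr mulmxDl cX// cY. Qed.
Lemma commutantZ a X : commutant G X -> commutant G (a *: X).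
Proof. by move=> cX g Gg; rewrite -scalemxAr -scalemxAl cX. Qed.
Lemma commutantN X : commutant G X -> commutant G (- X).
Proof. by rewrite -scaleN1r; exact: commutantZ. Qed.
Lemma commutantB X Y : commutant G X -> commutant G Y -> commutant G (X - Y).
Proof. by move=> cX cY; apply: commutantD => //; exact: commutantN. Qed.
Lemma commutant1 : commutant G 1%:M.
Proof. by move=> g _; rewrite mulmx1 mul1mx. Qed.

Hypothesis satG : saturated G.

Lemma sat_orthV g : G g -> g^T *m g = 1%:M.
Proof. by move=> /(sat_orth satG) /mulmx1C. Qed.

Lemma commutantT X : commutant G X -> commutant G X^T.
Proof.
move=> cX g Gg; apply: trmx_inj; rewrite !trmx_mul trmxK.
by rewrite cX//; exact: sat_tr.
Qed.

Lemma centreM g h : centre G g -> centre G h -> centre G (g *m h).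
Proof.
by move=> [Gg cg] [Gh ch]; split; [exact: sat_M|exact: commutantM].
Qed.
Lemma centreT g : centre G g -> centre G g^T.
Proof. by move=> [Gg cg]; split; [exact: sat_tr|exact: commutantT]. Qed.
Lemma centre1 : centre G 1%:M.
Proof. by split; [exact: sat_1|exact: commutant1]. Qed.

(** The sign picked up when g crosses h is squared away. *)
Lemma centre_sqr g : G g -> centre G (g *m g).
Proof.
move=> Gg; split=> [|h Gh]; first exact: sat_M.
by have [e|e] := sat_comm satG Gh Gg;
  rewrite [LHS]mulmxA e ?mulNmx -?[(g *m h) *m g]mulmxA e ?mulmxN ?opprK mulmxA.
Qed.

Lemma not_commutant_anticomm g : G g -> ~ commutant G g ->
  exists2 h, G h & h *m g = - (g *m h).
Proof.
move=> Gg ng; apply: contrapT => H; apply: ng => h Gh.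
have [//|anti] := sat_comm satG Gh Gg.
by exfalso; apply: H; exists h.
Qed.

(** Conjugation by h preserves the trace and changes the sign of X g. *)
Lemma mxtr_anticomm X g h : commutant G X -> G h -> h *m g = - (g *m h) ->
  \tr (X *m g) = 0.
Proof.
move=> cX Gh anti.
have e : h *m (X *m g) *m h^T = - (X *m g).
  rewrite mulmxA cX// -[X *m h *m g]mulmxA anti mulmxN mulNmx.
  by rewrite mulmxA -mulmxA (sat_orth satG)// mulmx1.
have : \tr (X *m g) = - \tr (X *m g).
  by rewrite -linearN -e [RHS]mxtrace_mulC (mulmxA h^T) sat_orthV// mul1mx.
move/eqP; rewrite -addr_eq0 -mulr2n mulrn_eq0 /= => /eqP //.
Qed.
End Commutant.

(** P is the projection onto a block on which the involutions of the centre act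
    by scalars. *)
Section Block.
Variables (G : set 'M[R]_n) (P : 'M[R]_n).
Hypothesis satG : saturated G.
Hypotheses (Pt : P^T = P) (PP : P *m P = P) (P0 : P != 0).
Hypothesis Pirr : forall b, involutive_centre G b -> exists e : R, b *m P = e *: P.

(** Let l be a nonzero eigenvalue of S = X^T X = - X^2, and Q the projection onto its
    eigenspace.  Then J = X Q / sqrt l satisfies J^2 = - Q, so the rotation by
    pi along J, which is 1 - 2 Q, is an involution of the centre.  It acts on
    the block by a scalar, which forces Q = P. *)
Lemma skew_block_sqr X : X^T = - X -> commutant G X -> P *m X = X -> X != 0 ->
  exists2 l : R, 0 < l & X *m X = - (l *: P).
Proof.
move=> Xt cX PX X0.
have XP : X *m P = X.
  by apply: trmx_inj; rewrite trmx_mul Pt Xt mulmxN PX.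
pose S := X^T *m X.
have St : S^T = S by rewrite /S trmx_mul trmxK.
have S0 : S != 0.
  apply: contra_neq X0 => S0; apply: mxtr_sqr_eq0.
  by rewrite -/S S0 mxtrace0.
have SP : S *m P = S by rewrite -mulmxA XP.
have cS : commutant G S by exact: (commutantM (commutantT satG cX) cX).
have SX : S *m X = X *m S by rewrite /S Xt !mulNmx mulmxN mulmxA.
have [l [l0 [v v0 vS]]] := symmetric_eigenvalue St S0.
have Sv : S *m v^T = l *: v^T.
  by apply: trmx_inj; rewrite trmx_mul St trmxK vS trmxZ trmxK.
have lgt0 : 0 < l.
  rewrite lt_def l0 /=.
  have := mxtr_sqr_ge0 (X *m v^T).
  rewrite trmx_mul mulmxA -(mulmxA _ X^T) -/S -mulmxA Sv -scalemxAr mxtraceZ.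
  rewrite pmulr_lge0//.
  rewrite lt_def (mxtr_sqr_ge0 v^T) andbT; apply: contra_neq v0 => /mxtr_sqr_eq0 v0.
  by rewrite -[v]trmxK v0 trmx0.
have [U HU] : exists U : {vspace 'cV[R]_n}, forall w, w \in U <-> S *m w = l *: w.
  apply: linear_pred_vspace => [|a u w Hu Hw]; first by rewrite mulmx0 scaler0.
  by rewrite mulmxDr -scalemxAr Hu Hw scalerDr !scalerA mulrC.
have [Q [Qt QQ UQ _]] := orthogonal_projection U.
have SQ : S *m Q = l *: Q.
  apply/matrixP => i j.
  have : S *m col j Q = l *: col j Q.
    by apply/HU/UQ; rewrite mulmx_col QQ.
  by rewrite mulmx_col => /colP/(_ i); rewrite !mxE.
have Qfix h : S *m h = h *m S -> S *m h^T = h^T *m S -> h *m Q = Q *m h.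
  move=> Sh Sht; have stab k : S *m k = k *m S -> k *m Q = Q *m k *m Q.
    move=> Sk; apply/matrixP => i j; rewrite -mulmxA.
    have : Q *m (k *m col j Q) = k *m col j Q.
      apply/UQ/HU; rewrite mulmxA Sk -mulmxA !mulmx_col SQ -scalemxAr.
      by apply/colP => p; rewrite !mxE.
    by rewrite !mulmx_col => /colP/(_ i); rewrite !mxE => ->.
  exact: projection_commutes (stab _ Sh) (stab _ Sht).
have cQ : commutant G Q.
  move=> g Gg; apply: Qfix; [by rewrite -cS|by rewrite -cS//; exact: sat_tr].
have QX : X *m Q = Q *m X by apply: Qfix; rewrite ?Xt ?mulmxN ?mulNmx SX.
have QP : Q *m P = Q.
  have : l *: (Q *m P) = l *: Q.
    have QS : Q *m S = l *: Q.
      by apply: trmx_inj; rewrite trmx_mul Qt St SQ trmxZ Qt.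
    by rewrite scalemxAl -QS -mulmxA SP.
  by move=> /(congr1 (fun Z => l^-1 *: Z)); rewrite !scalerA mulVf// !scale1r.
pose J := (Num.sqrt l)^-1 *: (X *m Q).
have JJ : J *m J = - Q.
  rewrite -scalemxAl -scalemxAr scalerA -invfM -expr2 sqr_sqrtr ?ltW//.
  rewrite {2}QX mulmxA -(mulmxA X) QQ -mulmxA -QX mulmxA.
  have -> : X *m X = - S by rewrite /S Xt mulNmx opprK.
  by rewrite mulNmx SQ scalerN scalerA mulVf// scale1r.
have JQ : J *m Q = J by rewrite /J -scalemxAl -mulmxA QQ.
have JJJ : J *m J *m J = - J.
  by rewrite -mulmxA JJ mulmxN JQ.
have Jt : J^T = - J.
  by rewrite /J -scalerN trmxZ trmx_mul Xt Qt mulmxN QX.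
have cJ : commutant G J by apply: commutantZ; exact: commutantM.
(* the rotation by pi: c = -1 and s = 0 *)
have Gb : G (1%:M + 0 *: J + (1 - (-1)) *: (J *m J)).
  by apply: sat_rot => //; rewrite sqrrN expr1n expr0n addr0.
have bE : 1%:M + 0 *: J + (1 - (-1)) *: (J *m J) = 1%:M - 2 *: Q.
  by rewrite scale0r addr0 opprK JJ scalerN.
have [e] : exists e : R, (1%:M - 2 *: Q) *m P = e *: P.
  apply: Pirr; split; first split; first by rewrite -bE.
    by apply: commutantB; [exact: commutant1|exact: commutantZ].
  rewrite mulmxBl mul1mx mulmxBr mulmx1 -scalemxAl -scalemxAr QQ scalerA.
  apply/matrixP => i j; rewrite !mxE; ring.
rewrite mulmxBl mul1mx -scalemxAl QP => QfP.
have {}QfP : Q = ((1 - e) / 2) *: P.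
  have : 2 *: Q = (1 - e) *: P by rewrite scalerBl scale1r -QfP opprB addrC subrK.
  by move=> /(congr1 (fun Z => 2^-1 *: Z)); rewrite !scalerA mulVf ?pnatr_eq0// scale1r mulrC.
have Q0 : Q != 0.
  apply: contra_neq v0 => Q0; apply: trmx_inj; rewrite trmx0.
  have : v^T \in U by apply/HU.
  by move=> /UQ <-; rewrite Q0 mul0mx.
have QEP : Q = P.
  move: QfP QQ Q0; set f := (1 - e) / 2 => ->.
  rewrite -scalemxAl -scalemxAr scalerA PP => ff; rewrite scaler_eq0 negb_or => /andP[f0 _].
  have : (f * f - f) *: P = 0 by rewrite scalerBl ff subrr.
  move/eqP; rewrite scaler_eq0 (negPf P0) orbF -[X in _ - X]mulr1 -mulrBr mulf_eq0 (negPf f0)/=.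
  by rewrite subr_eq0 => /eqP ->; rewrite scale1r.
exists l => //.
have -> : X *m X = - S by rewrite /S Xt mulNmx opprK.
by rewrite -SP -QEP SQ.
Qed.

(** Normalize one nonzero skew X to J with J^2 = - P.  If Y is another one, then Y
    commutes with J, and Y^2 and (Y + J)^2 are scalar on the block; so is
    2 Y J = (Y + J)^2 - Y^2 - J^2, and Y is a multiple of J. *)
Lemma skew_block_line : exists J, [/\ J^T = - J, commutant G J, P *m J = J,
  (J = 0 \/ J *m J = - P) &
  forall X, X^T = - X -> commutant G X -> P *m X = X -> exists s : R, X = s *: J].
Proof.
have [[X [Xt cX PX X0]]|noX] := pselect (exists X, [/\ X^T = - X, commutant G X,
    P *m X = X & X != 0]); last first.
  exists 0; split; rewrite ?mulmx0 ?trmx0 ?oppr0//.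
  - by move=> g _; rewrite mulmx0 mul0mx.
  - by left.
  - move=> X Xt cX PX; exists 0; rewrite scaler0.
    by apply: contrapT => /eqP X0; apply: noX; exists X.
have [l l0 XX] := skew_block_sqr Xt cX PX X0.
pose J := (Num.sqrt l)^-1 *: X.
have Jt : J^T = - J by rewrite /J trmxZ Xt scalerN.
have cJ : commutant G J by exact: commutantZ.
have PJ : P *m J = J by rewrite -scalemxAr PX.
have JJ : J *m J = - P.
  rewrite -scalemxAl -scalemxAr scalerA -invfM -expr2 sqr_sqrtr ?ltW//.
  by rewrite XX scalerN scalerA mulVf ?gt_eqF// scale1r.
clearbody J; exists J; split => //; first by right.
move=> Y Yt cY PY.
have sqr Z : Z^T = - Z -> commutant G Z -> P *m Z = Z -> exists c, Z *m Z = c *: P.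
  move=> Zt cZ PZ; have [->|Z0] := eqVneq Z 0; first by exists 0; rewrite mulmx0 scale0r.
  by have [c _ ->] := skew_block_sqr Zt cZ PZ Z0; exists (- c); rewrite scaleNr.
have [c YY] := sqr _ Yt cY PY.
have [d DD] : exists d, (Y + J) *m (Y + J) = d *: P.
  apply: sqr; [by rewrite linearD/= Yt Jt opprD|exact: commutantD|by rewrite mulmxDr PY PJ].
have YJ : J *m Y = Y *m J by apply: sat_central Jt cJ cY.
exists (- ((d + 1 - c) / 2)).
have : 2 *: (Y *m J) = (d + 1 - c) *: P.
  rewrite [RHS]scalerBl [X in _ = X - _]scalerDl -DD -YY mulmxDl !mulmxDr YJ JJ scale1r.
  apply/matrixP => i j; rewrite ![in LHS]mxE ![in RHS]mxE; ring.
move=> /(congr1 (fun Z => 2^-1 *: Z *m J)).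
rewrite !scalerA mulVf ?pnatr_eq0// scale1r -mulmxA JJ -scalemxAl PJ.
rewrite mulmxN => /(congr1 -%R); rewrite opprK.
have -> : Y *m P = Y by apply: trmx_inj; rewrite trmx_mul Pt Yt mulmxN PY.
by move=> ->; rewrite scaleNr mulrC.
Qed.
End Block.
End Saturated.

(** * The centre acts on each block by complex or real scalars *)

Section Blocks.
Variables (R : realType) (n s : nat).
Implicit Types (G : set 'M[R]_n) (X Y S g h z : 'M[R]_n) (P J : 'I_s -> 'M[R]_n).

Record block_decomposition P : Prop := BlockDecomposition {
  bd_sym : forall i, (P i)^T = P i;
  bd_idem : forall i, P i *m P i = P i;
  bd_neq0 : forall i, P i != 0;
  bd_orth : forall i j, i != j -> P i *m P j = 0;
  bd_sum : \sum_i P i = 1%:M }.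

Record adapted G P : Prop := Adapted {
  ad_com : forall i, commutant G (P i);
  ad_irr : forall i b, involutive_centre G b -> exists e : R, b *m P i = e *: P i }.

(** Real and complex blocks are treated together: a block is real when J i = 0, and
    then P i, J i span the real scalars; otherwise they span a copy of the
    complex numbers. *)
Record complex_structures G P J : Prop := ComplexStructures {
  cs_skew : forall i, (J i)^T = - J i;
  cs_com : forall i, commutant G (J i);
  cs_block : forall i, P i *m J i = J i;
  cs_sqr : forall i, J i = 0 \/ J i *m J i = - P i;
  cs_line : forall i X, X^T = - X -> commutant G X -> P i *m X = X ->
    exists r : R, X = r *: J i }.

Lemma exists_complex_structures G P : saturated G -> block_decomposition P -> adapted G P ->
  exists J, complex_structures G P J.
Proof.
move=> satG bdP adP.
have /choice[J HJ] i := skew_block_line satG (bd_sym bdP i) (bd_idem bdP i) (bd_neq0 bdP i)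
  (@ad_irr _ _ adP i).
by exists J; split=> i; have [] := HJ i.
Qed.

Section WithP.
Variable P : 'I_s -> 'M[R]_n.
Hypothesis bdP : block_decomposition P.

Lemma mx_block_ext p (X Y : 'M[R]_(p, n)) : (forall i, X *m P i = Y *m P i) -> X = Y.
Proof.
move=> XY; rewrite -[X]mulmx1 -[Y]mulmx1 -(bd_sum bdP) !mulmx_sumr.
by apply: eq_bigr => i _.
Qed.

Section WithG.
Variables (G : set 'M[R]_n) (J : 'I_s -> 'M[R]_n).
Hypotheses (satG : saturated G) (adP : adapted G P) (csJ : complex_structures G P J).

Lemma cs_blockr i : J i *m P i = J i.
Proof.
by apply: trmx_inj; rewrite trmx_mul (bd_sym bdP) (cs_skew csJ) mulmxN (cs_block csJ).
Qed.

Lemma cs_cube i : J i *m J i *m J i = - J i.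
Proof.
by have [->|->] := cs_sqr csJ i; rewrite ?mulmx0 ?oppr0// mulNmx (cs_block csJ).
Qed.

Lemma cs_other i j : i != j -> J i *m P j = 0.
Proof. by move=> ij; rewrite -cs_blockr -mulmxA (bd_orth bdP ij) mulmx0. Qed.

(** The product over the blocks of the rotations exp (r_i J_i): the phases on the
    complex blocks can be prescribed independently. *)
Lemma exists_phases (c t : 'I_s -> R) : (forall i, c i ^+ 2 + t i ^+ 2 = 1) ->
  exists2 z, centre G z &
    forall i, z *m P i = P i + t i *: J i + (1 - c i) *: (J i *m J i).
Proof.
move=> ct.
suff [z cz zP] : exists2 z, centre G z & forall i, z *m P i =
    if i \in enum 'I_s then P i + t i *: J i + (1 - c i) *: (J i *m J i) else P i.
  by exists z => // i; rewrite zP mem_enum.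
elim: (enum 'I_s) (enum_uniq 'I_s) => [_|j r IH /= /andP[jr /IH[z cz zP]]].
  by exists 1%:M; [exact: centre1|move=> i; rewrite mul1mx].
pose y := 1%:M + t j *: J j + (1 - c j) *: (J j *m J j).
have cJ := cs_com csJ j.
have cy : centre G y.
  split; first by apply: sat_rot => //; [exact: cs_skew csJ j|exact: cs_cube].
  by apply: commutantD; [apply: commutantD; [exact: commutant1|exact: commutantZ]|
    apply: commutantZ; exact: commutantM].
exists (y *m z); first exact: centreM.
move=> i; rewrite -mulmxA zP in_cons; case: eqVneq => [->|ij] /=.
  rewrite (negPf jr) mulmxDl mulmxDl mul1mx -scalemxAl cs_blockr -scalemxAl.
  by rewrite -mulmxA cs_blockr.
have yP : y *m P i = P i.
  rewrite mulmxDl mulmxDl mul1mx -scalemxAl -scalemxAl -mulmxA cs_other 1?eq_sym//.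
  by rewrite mulmx0 !scaler0 !addr0.
case: ifP => // _; rewrite !mulmxDr yP -!scalemxAr mulmxA.
by rewrite -(cs_block csJ i) !mulmxA yP.
Qed.

Lemma phase_block (c t : R) i : J i *m J i = - P i ->
  P i + t *: J i + (1 - c) *: (J i *m J i) = c *: P i + t *: J i.
Proof.
move=> ->; apply/matrixP => p q; rewrite ![in LHS]mxE ![in RHS]mxE; ring.
Qed.

(** The skew part of X is a multiple of J; since J is central in the commutant, the
    symmetric part times J is skew, hence also a multiple of J. *)
Lemma complex_block_commutant i X : J i != 0 -> commutant G X ->
  P i *m X = X -> X *m P i = X -> exists c t : R, X = c *: P i + t *: J i.
Proof.
move=> Ji0 cX PX XP.
have JJ : J i *m J i = - P i by case: (cs_sqr csJ i) => // /eqP; rewrite (negPf Ji0).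
have PXt : P i *m X^T = X^T by rewrite -[in RHS]XP trmx_mul (bd_sym bdP).
have cXt := commutantT satG cX.
have [t Xt] : exists t, X - X^T = t *: J i.
  apply: cs_line csJ _ _ _ _ _; [|exact: commutantB|by rewrite mulmxBr PX PXt].
  by rewrite linearB/= trmxK opprB.
have cS : commutant G (X + X^T) by exact: commutantD.
have SJ : J i *m (X + X^T) = (X + X^T) *m J i.
  exact: sat_central (cs_skew csJ i) (cs_com csJ i) cS.
have [c Sc] : exists c, (X + X^T) *m J i = c *: J i.
  apply: cs_line csJ _ _ _ _ _.
  - by rewrite trmx_mul (cs_skew csJ) linearD/= trmxK mulNmx (addrC X^T) SJ.
  - by apply: commutantM => //; exact: (cs_com csJ).
  - by rewrite mulmxA mulmxDr PX PXt.
have {}Sc : X + X^T = c *: P i.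
  have := congr1 (fun Y => Y *m - J i) Sc.
  rewrite -mulmxA mulmxN JJ opprK -scalemxAl mulmxN JJ opprK => <-.
  rewrite mulmxDl XP; congr (_ + _).
  by apply: trmx_inj; rewrite trmx_mul (bd_sym bdP) trmxK PX.
exists (c / 2), (t / 2).
have : 2 *: X = c *: P i + t *: J i.
  by rewrite -Sc -Xt scaler_nat mulr2n addrACA subrr addr0.
move=> /(congr1 (fun Z => 2^-1 *: Z)); rewrite scalerA mulVf ?pnatr_eq0// scale1r => ->.
by rewrite scalerDr !scalerA !(mulrC 2^-1).
Qed.

Lemma complex_block_unit i X c t : J i != 0 -> X *m X^T = 1%:M -> P i *m X = X *m P i ->
  X *m P i = c *: P i + t *: J i -> c ^+ 2 + t ^+ 2 = 1.
Proof.
move=> Ji0 XX PX XE.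
have JJ : J i *m J i = - P i by case: (cs_sqr csJ i) => // /eqP; rewrite (negPf Ji0).
have : (X *m P i) *m (X *m P i)^T = P i.
  by rewrite trmx_mul (bd_sym bdP) mulmxA -(mulmxA X) (bd_idem bdP) -PX -mulmxA XX mulmx1.
rewrite XE linearD/= !trmxZ (bd_sym bdP) (cs_skew csJ) mulmxDl !mulmxDr -!scalemxAl -!scalemxAr.
rewrite (bd_idem bdP) !mulmxN JJ cs_blockr (cs_block csJ) opprK => H.
have : (c ^+ 2 + t ^+ 2 - 1) *: P i = 0.
  rewrite scalerBl scale1r -[X in _ - X]H; apply/matrixP => p q.
  rewrite ![in LHS]mxE ![in RHS]mxE; ring.
by move/eqP; rewrite scaler_eq0 (negPf (bd_neq0 bdP i)) orbF subr_eq0 => /eqP.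
Qed.

Lemma real_block_sym i X : J i = 0 -> commutant G X -> P i *m X = X -> X *m P i = X ->
  X^T = X.
Proof.
move=> Ji0 cX PX XP.
have PXt : P i *m X^T = X^T by rewrite -{2}XP trmx_mul (bd_sym bdP).
have [|||r] := cs_line csJ (i := i) (X := X - X^T).
- by rewrite linearB/= trmxK opprB.
- by apply: commutantB => //; exact: commutantT.
- by rewrite mulmxBr PX PXt.
by rewrite Ji0 scaler0 => /eqP; rewrite subr_eq0 => /eqP <-.
Qed.

(** On complex blocks this is complex_block_commutant.  For the real ones, cancel the
    complex phases of z by an element w of the centre: on a real block w z is
    z, which is symmetric and orthogonal, so that w z is an involution of the
    centre, and these act by scalars on every block. *)
Lemma centre_block z : centre G z -> exists c t : 'I_s -> R,
  forall i, [/\ c i ^+ 2 + t i ^+ 2 = 1, z *m P i = c i *: P i + t i *: J i &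
    J i = 0 -> t i = 0].
Proof.
move=> [Gz cz].
have zz := sat_orth satG Gz.
have Pz i : P i *m z = z *m P i by rewrite (ad_com adP).
have H i : exists ct : R * R, ct.1 ^+ 2 + ct.2 ^+ 2 = 1 /\
    (J i != 0 -> z *m P i = ct.1 *: P i + ct.2 *: J i).
  have [->|Ji0] := eqVneq (J i) 0; first by exists (1, 0); rewrite /= expr1n expr0n addr0.
  have [|||c [t zE]] := @complex_block_commutant i (z *m P i) Ji0.
  - by apply: commutantM => //; exact: ad_com.
  - by rewrite mulmxA Pz -mulmxA (bd_idem bdP).
  - by rewrite -mulmxA (bd_idem bdP).
  by exists (c, t); split=> //=; exact: (complex_block_unit Ji0 zz (Pz i) zE).
have /choice[ct Hct] := H.
have [|w cw wP] := @exists_phases (fun i => (ct i).1) (fun i => - (ct i).2).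
  by move=> i; rewrite sqrrN; case: (Hct i).
have Jcase i : J i != 0 -> J i *m J i = - P i.
  by case: (cs_sqr csJ i) => [->|//]; rewrite eqxx.
have wzP i : w *m z *m P i = if J i == 0 then z *m P i else P i.
  rewrite -mulmxA; have [Ji0|Ji0] := eqVneq (J i) 0.
    by rewrite -Pz mulmxA wP Ji0 mulmx0 !scaler0 !addr0 Pz.
  have [ct1 ->] := Hct i; last exact: Ji0.
  rewrite mulmxDr -!scalemxAr -(cs_block csJ i) mulmxA wP (Jcase _ Ji0).
  rewrite !mulmxDl -!scalemxAl mulNmx (cs_block csJ) (Jcase _ Ji0).
  rewrite -[RHS]scale1r -[X in _ = X *: _]ct1; apply/matrixP => p q.
  rewrite ![in LHS]mxE ![in RHS]mxE; ring.
have zzP i : J i = 0 -> z *m (z *m P i) = P i.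
  move=> Ji0; have : (z *m P i)^T = z *m P i.
    apply: real_block_sym Ji0 _ _ _; last by rewrite -mulmxA (bd_idem bdP).
      by apply: commutantM => //; exact: (ad_com adP).
    by rewrite mulmxA Pz -mulmxA (bd_idem bdP).
  rewrite trmx_mul (bd_sym bdP) => <-.
  by rewrite mulmxA -Pz -mulmxA zz mulmx1.
have binv : involutive_centre G (w *m z).
  have cwz : centre G (w *m z) by exact: centreM.
  split=> //; apply: mx_block_ext => i; rewrite mul1mx -mulmxA wzP.
  case: eqVneq => Ji0; last by rewrite wzP (negPf Ji0).
  by rewrite -Pz mulmxA wzP Ji0 eqxx -mulmxA Pz zzP.
have Hb i : exists e : R, z *m P i = if J i == 0 then e *: P i else z *m P i.
  have [e eP] := ad_irr adP i binv; exists e.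
  by move: eP; rewrite wzP; case: eqVneq.
have /choice[e He] := Hb.
exists (fun i => if J i == 0 then e i else (ct i).1),
  (fun i => if J i == 0 then 0 else (ct i).2) => i.
have := He i; case: eqVneq => [Ji0 zE|Ji0 _]; last first.
  have [? H2] := Hct i; split=> //; first exact: H2.
  by move=> J0; rewrite J0 eqxx in Ji0.
rewrite expr0n addr0 scale0r addr0; split=> //.
have := zzP _ Ji0; rewrite zE -scalemxAr zE scalerA => eeP.
have /eqP : (e i * e i - 1) *: P i = 0 by rewrite scalerBl eeP scale1r subrr.
by rewrite scaler_eq0 (negPf (bd_neq0 bdP i)) orbF subr_eq0 => /eqP.
Qed.
End WithG.
End WithP.
End Blocks.

(** * Averaging over the group modulo its centre *)

Section Averaging.
Variables (R : realType) (n : nat) (I : finType).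
Implicit Types (X Y S T M g h z : 'M[R]_n).

Lemma mul_delta_mxE (A B : 'M[R]_n) i j p q :
  (A *m delta_mx i j *m B) p q = A p i * B j q.
Proof.
rewrite mxE (bigD1 j)//= big1 ?addr0 => [|k kj]; last first.
  rewrite mxE big1 ?mul0r// => l _; rewrite mxE (negPf kj) andbF mulr0 //.
rewrite mxE (bigD1 i)//= big1 ?addr0 => [|k ki]; first by rewrite mxE !eqxx mulr1.
by rewrite mxE (negPf ki) mulr0.
Qed.

(** The trace of the linear operator M |-> A M B on matrices, computed in the basis
    of matrix units. *)
Lemma sum_mul_delta (A B : 'M[R]_n) :
  \sum_i \sum_j (A *m delta_mx i j *m B) i j = \tr A * \tr B.
Proof.
rewrite /mxtrace mulr_suml; apply: eq_bigr => i _; rewrite mulr_sumr.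
by apply: eq_bigr => j _; rewrite mul_delta_mxE.
Qed.

Lemma mxtr_mul_delta (A : 'M[R]_n) i j : \tr (A *m delta_mx i j) = A j i.
Proof.
rewrite -[_ *m _]mulmx1 /mxtrace (eq_bigr (fun p => A p i * (1%:M : 'M[R]_n) j p)); last first.
  by move=> p _; rewrite mul_delta_mxE.
rewrite (bigD1 j)//= big1 ?addr0 => [|p pj]; rewrite mxE ?eqxx ?mulr1//.
by rewrite eq_sym (negPf pj) mulr0.
Qed.

Record transversal (G : set 'M[R]_n) (a : I -> 'M[R]_n) : Prop := Transversal {
  tv_in : forall i, G (a i);
  tv_ex : forall g, G g -> exists i z, centre G z /\ g = z *m a i;
  tv_uniq : forall i j z, centre G z -> a i = z *m a j -> i = j }.

Variables (G : set 'M[R]_n) (a : I -> 'M[R]_n).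
Hypotheses (satG : saturated G) (tvG : transversal G a).

Lemma transversal_shift h : G h -> exists (tau : I -> I) (z : I -> 'M[R]_n),
  injective tau /\ forall i, centre G (z i) /\ h *m a i = z i *m a (tau i).
Proof.
move=> Gh; have H i : exists jz : I * 'M[R]_n, centre G jz.2 /\ h *m a i = jz.2 *m a jz.1.
  have [j [z [cz e]]] := tv_ex tvG (sat_M satG Gh (tv_in tvG i)).
  by exists (j, z).
have /choice[jz Hjz] := H.
exists (fun i => (jz i).1), (fun i => (jz i).2); split=> // i j tij.
have [ci ei] := Hjz i; have [cj ej] := Hjz j.
apply: (tv_uniq tvG (z := (jz i).2 *m (jz j).2^T)).
  by apply: centreM => //; exact: centreT.
have cij : centre G ((jz i).2 *m (jz j).2^T) by apply: centreM => //; exact: centreT.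
have e : h *m a i = h *m (((jz i).2 *m (jz j).2^T) *m a j).
  rewrite ei tij [RHS]mulmxA (cij.2 _ Gh) -[RHS]mulmxA ej -[RHS]mulmxA.
  by rewrite (mulmxA _^T) (sat_orthV satG cj.1) mul1mx.
by rewrite -[LHS]mul1mx -(sat_orthV satG Gh) -mulmxA e mulmxA (sat_orthV satG Gh) mul1mx.
Qed.

Lemma transversal_one : exists i0, centre G (a i0) /\
  forall i, i != i0 -> ~ commutant G (a i).
Proof.
have [i0 [z [cz e]]] := tv_ex tvG (sat_1 satG).
have a0 : a i0 = z^T.
  by rewrite -[LHS]mul1mx -(sat_orthV satG cz.1) -mulmxA -e mulmx1.
have c0 : centre G (a i0) by rewrite a0; exact: centreT.
exists i0; split=> // i ii0 ci; move/eqP: ii0; apply.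
apply: (tv_uniq tvG (z := a i *m (a i0)^T)).
  by apply: centreM => //; [split=> //; exact: (tv_in tvG)|exact: centreT].
by rewrite -mulmxA (sat_orthV satG c0.1) mulmx1.
Qed.

Lemma transversal_trace i0 i X : (forall j, j != i0 -> ~ commutant G (a j)) ->
  i != i0 -> commutant G X -> \tr (X *m a i) = 0 /\ \tr (X *m (a i)^T) = 0.
Proof.
move=> H ii0 cX; have Ga := tv_in tvG i; have Gat := sat_tr satG Ga.
have [h Gh ha] := not_commutant_anticomm satG Ga (H _ ii0).
have [k Gk ka] : exists2 h, G h & h *m (a i)^T = - ((a i)^T *m h).
  apply: not_commutant_anticomm => // /(commutantT satG); rewrite trmxK; exact: H.
by split; [exact: (mxtr_anticomm satG cX Gh ha)|exact: (mxtr_anticomm satG cX Gk ka)].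
Qed.

Section OneBlock.
Variables (P J : 'M[R]_n).
Hypotheses (Pt : P^T = P) (PP : P *m P = P) (P0 : P != 0) (cP : commutant G P).
Hypotheses (Jt : J^T = - J) (cJ : commutant G J) (PJ : P *m J = J) (JP : J *m P = J).
Hypothesis JJ : J = 0 \/ J *m J = - P.
Hypothesis cenP : forall z, centre G z ->
  exists c t, [/\ c ^+ 2 + t ^+ 2 = 1, z *m P = c *: P + t *: J & J = 0 -> t = 0].

(** Conjugation by an element of the centre is conjugation by a unit complex number
    on the block; it is trivial on maps commuting with J.  Adding the conjugate
    by J makes T commute with J, and so makes the average below independent of
    the transversal. *)
Definition twirl T := T + J *m T *m J^T.

(** Locked, so that rewriting with associativity does not split the product. *)
Definition restr : I -> 'M[R]_n := locked (fun i => a i *m P).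

Lemma restrE i : restr i = a i *m P. Proof. by rewrite /restr -lock. Qed.

Definition average M := \sum_i twirl (restr i *m M *m (restr i)^T).

Lemma restrP i : restr i *m P = restr i.
Proof. by rewrite restrE -mulmxA PP. Qed.
Lemma Prestr i : P *m restr i = restr i.
Proof. by rewrite restrE mulmxA -(cP (tv_in tvG i)) -mulmxA PP. Qed.
Lemma trestrP i : (restr i)^T *m P = (restr i)^T.
Proof. by rewrite -[in LHS]Pt -trmx_mul Prestr. Qed.
Lemma trestr_restr i : (restr i)^T *m restr i = P.
Proof.
by rewrite restrE trmx_mul Pt -mulmxA (mulmxA _ _ P) (sat_orthV satG (tv_in tvG i)) mul1mx PP.
Qed.

Lemma twirl_comJ T : P *m T = T -> T *m P = T -> J *m twirl T = twirl T *m J.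
Proof.
move=> PT TP; rewrite /twirl Jt mulmxN; have [->|JJP] := JJ.
  by rewrite !mul0mx !mulmx0.
rewrite mulmxBr mulmxBl !mulmxA JJP -(mulmxA _ J J) JJP mulmxN !mulNmx PT -mulmxA TP.
by rewrite !opprK addrC.
Qed.

Lemma twirl_rot T c t : P *m T = T -> T *m P = T -> c ^+ 2 + t ^+ 2 = 1 ->
  (J = 0 -> t = 0) ->
  let E := c *: P + t *: J in twirl (E *m T *m E^T) = twirl T.
Proof.
move=> PT TP ct t0 E.
have EJ : J *m E = E *m J.
  by rewrite mulmxDr mulmxDl -!scalemxAr -!scalemxAl PJ JP.
have Et : E^T = c *: P - t *: J.
  by rewrite linearD/= !trmxZ Pt Jt scalerN.
have JEt : J *m E^T = E^T *m J.
  by rewrite Et mulmxBr mulmxBl -!scalemxAr -!scalemxAl PJ JP.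
have -> : twirl (E *m T *m E^T) = E *m twirl T *m E^T.
  rewrite /twirl mulmxDr mulmxDl; congr (_ + _).
  rewrite Jt !mulmxN !mulNmx; congr (- _).
  by rewrite !mulmxA EJ -!mulmxA JEt.
have PW : P *m twirl T = twirl T by rewrite /twirl mulmxDr PT !mulmxA PJ.
have WP : twirl T *m P = twirl T by rewrite /twirl mulmxDl TP Jt mulmxN mulNmx -mulmxA JP.
have WJ := twirl_comJ PT TP; move: (twirl T) PW WP WJ => W PW WP WJ.
have EW : E *m W = W *m E.
  by rewrite /E mulmxDr mulmxDl -!scalemxAr -!scalemxAl WJ PW WP.
rewrite EW -mulmxA.
suff -> : E *m E^T = P by [].
rewrite Et mulmxDl !mulmxBr -!scalemxAl -!scalemxAr PP PJ JP !scalerA.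
have [J0|->] := JJ.
  rewrite J0 mulmx0 !scaler0 !subr0 !addr0 -expr2.
  by move: ct; rewrite (t0 J0) expr0n addr0 => ->; rewrite scale1r.
rewrite -[RHS]scale1r -[X in _ = X *: _]ct; apply/matrixP => p q.
rewrite ![in LHS]mxE ![in RHS]mxE; ring.
Qed.

Lemma restr_com X i : commutant G X -> P *m X = X -> X *m P = X ->
  X *m restr i = restr i *m X.
Proof.
by move=> cX PX XP; rewrite restrE mulmxA -(cX _ (tv_in tvG i)) -!mulmxA XP PX.
Qed.

Lemma restrJ i : J *m restr i = restr i *m J.
Proof. exact: restr_com. Qed.

(** Left multiplication by h permutes the transversal up to the centre, whose effect
    is absorbed by twirl_rot. *)
Lemma average_commutant M : commutant G (average M).
Proof.
move=> h Gh; suff e : h *m average M *m h^T = average M.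
  by rewrite -{2}e -!mulmxA (sat_orthV satG Gh) mulmx1.
have [tau [z [tinj tz]]] := transversal_shift Gh.
rewrite /average mulmx_sumr mulmx_suml [RHS](reindex_inj tinj) /=.
apply: eq_bigr => i _; have [cz hz] := tz i.
have [c [t [ct zP t0]]] := cenP cz.
set T := restr (tau i) *m M *m (restr (tau i))^T.
have PT : P *m T = T by rewrite /T !mulmxA Prestr.
have TP : T *m P = T by rewrite /T -mulmxA trestrP.
rewrite -(twirl_rot PT TP ct t0) -zP.
have hr : h *m restr i = (z i *m P) *m restr (tau i).
  by rewrite -mulmxA Prestr !restrE mulmxA hz -mulmxA.
have -> : (z i *m P) *m T *m (z i *m P)^T =
    h *m (restr i *m M *m (restr i)^T) *m h^T.
  rewrite /T !mulmxA hr -!mulmxA; congr (_ *m (_ *m _)); rewrite -!trmx_mul.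
  by rewrite hr -mulmxA Prestr.
rewrite /twirl mulmxDr mulmxDl; congr (_ + _).
rewrite !mulmxA (cJ Gh) -!mulmxA; do 5!congr (_ *m _).
by rewrite -!trmx_mul (cJ Gh).
Qed.

Lemma average_block M : P *m average M = average M /\ average M *m P = average M.
Proof.
rewrite /average mulmx_sumr mulmx_suml; split; apply: eq_bigr => i _.
  by rewrite /twirl mulmxDr !mulmxA Prestr PJ.
by rewrite /twirl mulmxDl -!mulmxA trestrP Jt mulNmx JP.
Qed.

Lemma average_tr M : \tr (average M) =
  #|I|%:R * (\tr (P *m M) + \tr (J^T *m J *m M)).
Proof.
rewrite /average raddf_sum/= (eq_bigr (fun=> \tr (P *m M) + \tr (J^T *m J *m M))).
  by rewrite sumr_const mulr_natl.
move=> i _; rewrite /twirl mxtraceD; congr (_ + _).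
  by rewrite mxtrace_mulC mulmxA trestr_restr.
rewrite !mulmxA restrJ -(mulmxA _ _ J^T) -trmx_mul restrJ mxtrace_mulC.
by rewrite trmx_mul !mulmxA -(mulmxA _ _ (restr i)) trestr_restr -(mulmxA _ P) PJ.
Qed.

Lemma restr_one : exists i0 c t, [/\ c ^+ 2 + t ^+ 2 = 1, J = 0 -> t = 0,
   restr i0 = c *: P + t *: J &
   forall i X, i != i0 -> commutant G X ->
     \tr (X *m restr i) = 0 /\ \tr (X *m (restr i)^T) = 0].
Proof.
have [i0 [ci0 H]] := transversal_one.
have [c [t [ct e t0]]] := cenP ci0.
exists i0, c, t; split=> //; first by rewrite restrE.
move=> i X ii0 cX; rewrite restrE trmx_mul Pt.
have [e1 _] := transversal_trace H ii0 (commutantM cP cX).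
have [_ e2] := transversal_trace H ii0 (commutantM cX cP).
by split; [rewrite mulmxA mxtrace_mulC mulmxA|rewrite mulmxA].
Qed.

Lemma trJ : \tr J = 0.
Proof.
have /eqP : \tr J = - \tr J by rewrite -[LHS]mxtrace_tr Jt linearN.
by rewrite -addr_eq0 -mulr2n mulrn_eq0 /= => /eqP.
Qed.

Lemma trP_gt0 : 0 < \tr P. Proof. exact: mxtr_gt0. Qed.

(** The commutant of the block consists of symmetric matrices, hence it is
    commutative, and S M and M S have the same average for every M.  Take for M
    the matrix units (i, j), read the entry (p, j), and sum over j: the elements
    of the transversal outside the centre contribute nothing because their
    traces against the commutant vanish, and what remains is
    S tr P = P tr S. *)
Lemma real_block_scalar : J = 0 ->
  (forall X, commutant G X -> P *m X = X -> X *m P = X -> X^T = X) ->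
  forall S, commutant G S -> P *m S = S -> S *m P = S -> exists c, S = c *: P.
Proof.
move=> J0 sym S cS PS SP.
have tw T : twirl T = T by rewrite /twirl J0 !mul0mx addr0.
have [i0 [c [t [ct t0 r0 H]]]] := restr_one.
have rS i := restr_com i cS PS SP.
have St := sym _ cS PS SP.
have rtS i : S *m (restr i)^T = (restr i)^T *m S.
  by apply: trmx_inj; rewrite !trmx_mul trmxK St rS.
have E M : average (S *m M) = average (M *m S).
  have [PA AP] := average_block M; have cA := average_commutant M.
  have -> : average (S *m M) = S *m average M.
    rewrite /average mulmx_sumr; apply: eq_bigr => i _.
    by rewrite !tw !mulmxA rS.
  have -> : average (M *m S) = average M *m S.
    rewrite /average mulmx_suml; apply: eq_bigr => i _.
    by rewrite !tw -!mulmxA rtS.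
  have : (S *m average M)^T = S *m average M.
    apply: sym; [exact: commutantM|by rewrite mulmxA PS|by rewrite -mulmxA AP].
  by rewrite trmx_mul St (sym _ cA PA AP) => ->.
exists (\tr S / \tr P); apply/matrixP => p i; rewrite mxE.
have : \sum_j average (S *m delta_mx i j) p j = \sum_j average (delta_mx i j *m S) p j.
  by apply: eq_bigr => j _; rewrite E.
rewrite /average; under eq_bigr do rewrite summxE.
under [RHS]eq_bigr do rewrite summxE.
rewrite exchange_big [RHS]exchange_big /=.
have L k : \sum_j twirl (restr k *m (S *m delta_mx i j) *m (restr k)^T) p j =
    (restr k *m S) p i * \tr (restr k)^T.
  rewrite /mxtrace mulr_sumr; apply: eq_bigr => j _.
  by rewrite tw mulmxA mul_delta_mxE.
have L' k : \sum_j twirl (restr k *m (delta_mx i j *m S) *m (restr k)^T) p j =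
    restr k p i * \tr (S *m (restr k)^T).
  rewrite /mxtrace mulr_sumr; apply: eq_bigr => j _.
  by rewrite tw mulmxA -(mulmxA _ S) mul_delta_mxE.
under eq_bigr do rewrite L; under [RHS]eq_bigr do rewrite L'.
rewrite (bigD1 i0)//= [X in _ + X]big1 => [|k ki0]; last first.
  by have [_] := H k _ ki0 (@commutant1 _ _ G); rewrite mul1mx => ->; rewrite mulr0.
rewrite [RHS](bigD1 i0)//= [X in _ = _ + X]big1 => [|k ki0]; last first.
  by have [_ ->] := H k _ ki0 cS; rewrite mulr0.
have t00 := t0 J0.
rewrite r0 t00 scale0r !addr0 trmxZ Pt mxtraceZ -scalemxAl -scalemxAr PS SP mxtraceZ !mxE.
move: ct; rewrite t00 expr0n addr0 => c1 e.
have : S p i * \tr P = P p i * \tr S.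
  transitivity (c ^+ 2 * (S p i * \tr P)); first by rewrite c1 mul1r.
  transitivity (c ^+ 2 * (P p i * \tr S)); last by rewrite c1 mul1r.
  by move: e; rewrite expr2; lra.
move=> /(canRL (mulfK (lt0r_neq0 trP_gt0))) ->; ring.
Qed.

(** Compute in two ways the trace of the operator M |-> average M.  Term by term, only
    the central element of the transversal contributes, which gives
    (tr P)^2.  On the other hand average M = e P + f J, where the traces of
    average M and of J^T average M determine e and f. *)
Lemma block_trace_sqr :
  (forall X, commutant G X -> P *m X = X -> X *m P = X -> exists c t, X = c *: P + t *: J) ->
  (\tr P) ^+ 2 = #|I|%:R * (if J == 0 then 1 else 4).
Proof.
move=> blockP; have [i0 [c [t [ct t0 r0 H]]]] := restr_one.
have dgt0 := trP_gt0.
have lhs : \sum_i \sum_j average (delta_mx i j) i j =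
    \sum_k (\tr (restr k) * \tr (restr k)^T + \tr (J *m restr k) * \tr (J *m restr k)^T).
  transitivity (\sum_k \sum_i \sum_j twirl (restr k *m delta_mx i j *m (restr k)^T) i j).
    rewrite [RHS]exchange_big; apply: eq_bigr => i _ /=.
    by rewrite [RHS]exchange_big; apply: eq_bigr => j _; rewrite /average summxE.
  apply: eq_bigr => k _; rewrite -!sum_mul_delta -big_split; apply: eq_bigr => i _ /=.
  rewrite -big_split; apply: eq_bigr => j _ /=.
  by rewrite /twirl mxE trmx_mul !mulmxA.
have {}lhs : \sum_i \sum_j average (delta_mx i j) i j = (\tr P) ^+ 2.
  rewrite lhs (bigD1 i0)//= [X in _ + X]big1 ?addr0 => [|k ki0]; last first.
    have [+ _] := H k _ ki0 (@commutant1 _ _ G); have [-> _] := H k _ ki0 cJ.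
    by rewrite mul1mx => ->; rewrite !mul0r addr0.
  rewrite !mxtrace_tr r0 mulmxDr -!scalemxAr JP !mxtraceD !mxtraceZ trJ.
  have [J0|->] := JJ.
    move: ct; rewrite (t0 J0) expr0n addr0 => c1; set d := \tr P.
    transitivity (c ^+ 2 * d ^+ 2); [ring|by rewrite c1 mul1r].
  rewrite linearN /= !mulr0 addr0 add0r; move: ct; set d := \tr P => ct.
  transitivity ((c ^+ 2 + t ^+ 2) * d ^+ 2); [ring|by rewrite ct mul1r].
have trPP : \sum_i \sum_j P j i * P i j = \tr P.
  rewrite -[in RHS]PP /mxtrace exchange_big; apply: eq_bigr => i _.
  by rewrite mxE.
rewrite -lhs; case: eqP => [J0|Jn0].
  have avg i j : average (delta_mx i j) i j = #|I|%:R / \tr P * (P j i * P i j).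
    have [PA AP] := average_block (delta_mx i j).
    have [e [f]] := blockP _ (average_commutant _) PA AP.
    rewrite J0 scaler0 addr0 => AE; have := average_tr (delta_mx i j).
    rewrite AE mxtraceZ J0 !mulmx0 mul0mx mxtrace0 addr0 mxtr_mul_delta mxE => ee.
    by rewrite (canRL (mulfK (lt0r_neq0 dgt0)) ee); ring.
  under eq_bigr do under eq_bigr do rewrite avg.
  under eq_bigr do rewrite -mulr_sumr.
  by rewrite -mulr_sumr trPP divfK ?lt0r_neq0// mulr1.
have JJP : J *m J = - P by case: JJ.
have JtJ : J^T *m J = P by rewrite Jt mulNmx JJP opprK.
have avg i j : average (delta_mx i j) i j =
    (#|I|%:R * 2) / \tr P * (P j i * P i j + J i j ^+ 2).
  have [PA AP] := average_block (delta_mx i j).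
  have [e [f AE]] := blockP _ (average_commutant _) PA AP.
  have := average_tr (delta_mx i j).
  rewrite AE mxtraceD !mxtraceZ trJ mulr0 addr0 JtJ mxtr_mul_delta => ee.
  have ff : f * \tr P = #|I|%:R * 2 * J i j.
    transitivity (\tr (J^T *m average (delta_mx i j))).
      rewrite AE mulmxDr -!scalemxAr mxtraceD !mxtraceZ JtJ.
      by rewrite Jt mulNmx JP linearN /= trJ oppr0 mulr0 add0r.
    rewrite /average mulmx_sumr raddf_sum/= (eq_bigr (fun=> 2 * J i j)).
      by rewrite sumr_const -[LHS]mulr_natl mulrA.
    move=> k _; rewrite /twirl mulmxDr mxtraceD.
    have -> : J^T *m (J *m (restr k *m delta_mx i j *m (restr k)^T) *m J^T) =
       restr k *m delta_mx i j *m (restr k)^T *m J^T.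
      by rewrite !mulmxA JtJ Prestr.
    have -> : J i j = \tr (J^T *m delta_mx i j) by rewrite mxtr_mul_delta mxE.
    rewrite [X in _ + X]mxtrace_mulC -mulr2n mulr_natl; congr (_ *+ 2).
    have JTr : J^T *m restr k = restr k *m J^T by rewrite Jt mulNmx restrJ mulmxN.
    rewrite !mulmxA JTr mxtrace_mulC !mulmxA.
    by rewrite trestr_restr Jt mulmxN PJ.
  rewrite mxE [(e *: P) i j]mxE [(f *: J) i j]mxE.
  rewrite (canRL (mulfK (lt0r_neq0 dgt0)) ee) (canRL (mulfK (lt0r_neq0 dgt0)) ff); ring.
have trJJ : \sum_i \sum_j J i j ^+ 2 = \tr P.
  rewrite -JtJ /mxtrace exchange_big; apply: eq_bigr => i _ /=.
  by rewrite mxE; apply: eq_bigr => j _; rewrite mxE expr2.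
under eq_bigr do under eq_bigr do rewrite avg.
under eq_bigr do rewrite -mulr_sumr big_split.
rewrite -mulr_sumr big_split /= trPP trJJ; field; exact: lt0r_neq0.
Qed.

End OneBlock.
End Averaging.

(** * Intertwining two groups that satisfy the same relations *)

Section Matching.
Variables (R : realType) (n s m : nat) (I : finType).
Implicit Types (G H : set 'M[R]_n) (X Y S T U M g h z : 'M[R]_n).

(** G is generated by its centre and the x b, in the form of an induction principle. *)
Record generating G (x : 'I_m -> 'M[R]_n) : Prop := Generating {
  gen_in : forall b, G (x b);
  gen_ind : forall H, (forall g h, H g -> H h -> H (g *m h)) ->
    (forall z, centre G z -> H z) -> (forall b, H (x b)) -> forall g, G g -> H g }.

Variable P : 'I_s -> 'M[R]_n.
Hypothesis bdP : block_decomposition P.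

Section OneGroup.
Variables (G : set 'M[R]_n) (J : 'I_s -> 'M[R]_n) (a : I -> 'M[R]_n).
Hypotheses (satG : saturated G) (adP : adapted G P) (csJ : complex_structures G P J).
Hypothesis tvG : transversal G a.

Lemma centre_block1 i z : centre G z -> exists c t : R,
  [/\ c ^+ 2 + t ^+ 2 = 1, z *m P i = c *: P i + t *: J i & J i = 0 -> t = 0].
Proof.
move=> cz; have [c [t ct]] := centre_block bdP satG adP csJ cz.
by exists (c i), (t i).
Qed.

Lemma block_commutant i X : commutant G X -> P i *m X = X -> X *m P i = X ->
  exists c t : R, X = c *: P i + t *: J i.
Proof.
move=> cX PX XP; have [J0|J0] := eqVneq (J i) 0; last first.
  exact: (complex_block_commutant bdP satG csJ).
have [c ->] := real_block_scalar satG tvG (bd_sym bdP i) (bd_idem bdP i) (bd_neq0 bdP i)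
  (ad_com adP i) (cs_skew csJ i) (cs_com csJ i) (cs_block csJ i) (cs_blockr bdP csJ i)
  (cs_sqr csJ i) (@centre_block1 i) J0
  (fun X => @real_block_sym _ _ _ _ bdP _ _ satG csJ i X J0) cX PX XP.
by exists c, 0; rewrite scale0r addr0.
Qed.

Lemma block_type i : (\tr (P i)) ^+ 2 = #|I|%:R * (if J i == 0 then 1 else 4).
Proof.
exact: (block_trace_sqr satG tvG (bd_sym bdP i) (bd_idem bdP i) (bd_neq0 bdP i)
  (ad_com adP i) (cs_skew csJ i) (cs_com csJ i) (cs_block csJ i) (cs_blockr bdP csJ i)
  (cs_sqr csJ i) (@centre_block1 i) (@block_commutant i)).
Qed.

(** W commutes with generators of G, with J and hence with the centre; so it lies in
    the commutant, e P + f J, and symmetry kills the second term. *)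
Lemma generated_scalar (x : 'I_m -> 'M[R]_n) i W : generating G x ->
  W^T = W -> P i *m W = W -> J i *m W = W *m J i -> (forall b, x b *m W = W *m x b) ->
  exists c, W = c *: P i.
Proof.
move=> gx Wt PW JW xW.
have WP : W *m P i = W by rewrite -[in LHS]Wt -(bd_sym bdP) -trmx_mul PW.
have cW : commutant G W.
  apply: (gen_ind gx (H := [set g | g *m W = W *m g])) => //= [g h gW hW|z cz].
    by rewrite -mulmxA hW mulmxA gW mulmxA.
  have [c [t [_ zP _]]] := centre_block1 i cz.
  have Pz : P i *m z = z *m P i by rewrite (ad_com adP i cz.1).
  rewrite -[in LHS]PW -[in RHS]WP -mulmxA Pz mulmxA zP.
  by rewrite mulmxDl mulmxDr -!scalemxAl -!scalemxAr PW WP JW.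
have [c [t WE]] := block_commutant cW PW WP.
exists c; rewrite WE; suff -> : t *: J i = 0 by rewrite addr0.
move: Wt; rewrite WE linearD/= !trmxZ (bd_sym bdP) (cs_skew csJ) scalerN => /addrI/eqP.
by rewrite eq_sym -addr_eq0 -mulr2n -scaler_nat scaler_eq0 pnatr_eq0 /= => /eqP.
Qed.

(** On a complex block g^2 is a unit complex number, and g is multiplied by a square
    root of its inverse. *)
Lemma exists_unit_square g : G g -> exists2 z, centre G z & forall i,
  (J i = 0 -> (z *m g) *m (z *m g) *m P i = g *m g *m P i) /\
  (J i != 0 -> (z *m g) *m (z *m g) *m P i = P i).
Proof.
move=> Gg; have [c [t Hct]] := centre_block bdP satG adP csJ (centre_sqr satG Gg).
(* c' + i t' is a square root of c - i t *)
pose c' i := Num.sqrt ((1 + c i) / 2).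
pose t' i := if c i == -1 then 1 else - t i / (2 * c' i).
have c1 i : -1 <= c i.
  have [ct _ _] := Hct i; have := sqr_ge0 (t i); nra.
have c'2 i : c' i ^+ 2 = (1 + c i) / 2.
  by rewrite sqr_sqrtr// divr_ge0//; have := c1 i; lra.
have H i : [/\ c' i ^+ 2 + t' i ^+ 2 = 1, c' i ^+ 2 - t' i ^+ 2 = c i &
    2 * (c' i * t' i) = - t i].
  have [ct _ _] := Hct i; rewrite c'2 /t'; case: eqVneq => [ci|ci].
    have t0 : t i = 0 by apply/eqP; rewrite -sqrf_eq0; apply/eqP; rewrite ci in ct; nra.
    have : c' i = 0 by apply/eqP; rewrite -sqrf_eq0 c'2 ci subrr mul0r.
    by move=> ->; rewrite ci t0; split; lra.
  have c1n : 1 + c i != 0 by rewrite addrC -[1]opprK subr_eq0.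
  have c'0 : c' i != 0.
    by rewrite -sqrf_eq0 c'2 mulf_neq0// invr_eq0 pnatr_eq0.
  have : (- t i / (2 * c' i)) ^+ 2 = (1 - c i) / 2.
    rewrite expr_div_n exprMn c'2 sqrrN.
    have -> : t i ^+ 2 = (1 - c i) * (1 + c i) by move: ct; nra.
    field; done.
  move=> ->; split; [lra|lra|]; field; done.
have [|w cw wP] := exists_phases bdP satG csJ (c := c') (t := t').
  by move=> i; case: (H i).
exists w => // i; have [ct gP _] := Hct i; have [h1 h2 h3] := H i.
have wg : (w *m g) *m (w *m g) *m P i = w *m (w *m (g *m g *m P i)).
  rewrite -!mulmxA; congr (w *m _); rewrite mulmxA (cw.2 _ Gg) -!mulmxA //.
rewrite wg; split=> Ji.
  rewrite gP Ji scaler0 addr0 -!scalemxAr wP Ji mulmx0 !scaler0 !addr0.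
  by rewrite wP Ji mulmx0 !scaler0 !addr0.
have JJ : J i *m J i = - P i by case: (cs_sqr csJ i) => // J0; rewrite J0 eqxx in Ji.
have wPE : w *m P i = c' i *: P i + t' i *: J i by rewrite wP phase_block.
have wJE : w *m J i = c' i *: J i - t' i *: P i.
  by rewrite -(cs_block csJ i) mulmxA wPE mulmxDl -!scalemxAl (cs_block csJ) JJ scalerN.
have wgP : w *m (g *m g *m P i) = c' i *: P i - t' i *: J i.
  have e1 : c i * c' i - t i * t' i = c' i.
    have -> : t i = - (2 * (c' i * t' i)) by rewrite h3 opprK.
    by rewrite -h2 -[RHS]mulr1 -[X in _ = _ * X]h1; ring.
  have e2 : c i * t' i + t i * c' i = - t' i.
    have -> : t i = - (2 * (c' i * t' i)) by rewrite h3 opprK.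
    by rewrite -h2 -[RHS]mulr1 -[X in _ = _ * X]h1; ring.
  rewrite gP mulmxDr -!scalemxAr wPE wJE -[in RHS]scaleNr.
  rewrite -[X in _ = _ + X *: _]e2 -[X in _ = X *: _ + _]e1.
  apply/matrixP => p q; rewrite ![in LHS]mxE ![in RHS]mxE; ring.
rewrite wgP mulmxBr -!scalemxAr wPE wJE -[RHS]scale1r -[X in _ = X *: _]h1.
apply/matrixP => p q; rewrite ![in LHS]mxE ![in RHS]mxE; ring.
Qed.
End OneGroup.

(** The operators L_b : X |-> x'_b X x_b^T on K are commuting involutions, so they have a
    common eigenvector: starting from any nonzero X, replace X by X + L_b X for
    each b in turn, unless this is 0, when L_b X = - X already. *)
Lemma conj_eigenvector (x x' : 'I_m -> 'M[R]_n) (K : set 'M[R]_n) X0 :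
  (forall X Y, K X -> K Y -> K (X + Y)) ->
  (forall b X, K X -> K (x' b *m X *m (x b)^T)) ->
  (forall b X, K X -> x' b *m (x' b *m X *m (x b)^T) *m (x b)^T = X) ->
  (forall b c X, K X -> x' b *m (x' c *m X *m (x c)^T) *m (x b)^T =
                     x' c *m (x' b *m X *m (x b)^T) *m (x c)^T) ->
  K X0 -> X0 != 0 ->
  exists X (eps : 'I_m -> bool), [/\ K X, X != 0 &
    forall b, x' b *m X *m (x b)^T = (-1) ^+ eps b *: X].
Proof.
move=> KD KL LL LC KX0 X00.
suff H (r : seq 'I_m) : exists X (eps : 'I_m -> bool), [/\ K X, X != 0 &
    forall b, b \in r -> x' b *m X *m (x b)^T = (-1) ^+ eps b *: X].
  have [X [eps [KX Xn0 HX]]] := H (enum 'I_m); exists X, eps; split=> // b.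
  by rewrite HX// mem_enum.
elim: r => [|b r [X [eps [KX Xn0 HX]]]]; first by exists X0, (fun=> false).
have [XL|XL] := eqVneq (X + x' b *m X *m (x b)^T) 0.
  exists X, (fun c => (c == b) || eps c); split=> // c; rewrite in_cons.
  case: eqVneq => [-> _|_ /= /HX //]; rewrite expr1 scaleN1r.
  by apply/eqP; rewrite -addr_eq0 addrC XL.
exists (X + x' b *m X *m (x b)^T), (fun c => (c != b) && eps c).
split=> //; first by apply: KD => //; exact: KL.
move=> c; rewrite in_cons; case: eqVneq => [-> _|_ /= /HX cX].
  by rewrite expr0 scale1r mulmxDr mulmxDl LL// addrC.
by rewrite mulmxDr mulmxDl LC// cX -scalemxAr -scalemxAl scalerDr.
Qed.

Definition commute_alike (x x' : 'I_m -> 'M[R]_n) := forall b c,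
  (x b *m x c = x c *m x b /\ x' b *m x' c = x' c *m x' b) \/
  (x b *m x c = - (x c *m x b) /\ x' b *m x' c = - (x' c *m x' b)).

Definition separating G (x : 'I_m -> 'M[R]_n) := forall eps : 'I_m -> bool,
  exists2 c, G c & forall b, c *m x b = (-1) ^+ eps b *: (x b *m c).

Section TwoGroups.
Variables (G G' : set 'M[R]_n) (J J' : 'I_s -> 'M[R]_n) (a a' : I -> 'M[R]_n).
Variables (x x' : 'I_m -> 'M[R]_n).
Hypotheses (satG : saturated G) (adP : adapted G P) (csJ : complex_structures G P J).
Hypotheses (tvG : transversal G a) (gx : generating G x).
Hypotheses (satG' : saturated G') (adP' : adapted G' P) (csJ' : complex_structures G' P J').
Hypotheses (tvG' : transversal G' a') (gx' : generating G' x').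
Hypotheses (xx' : commute_alike x x') (sepx : separating G x).

(** The type of a block can be read off its dimension. *)
Lemma same_type i : (J i == 0) = (J' i == 0).
Proof.
have := block_type satG adP csJ tvG i.
rewrite (block_type satG' adP' csJ' tvG' i).
have d0 := mxtr_gt0 (bd_sym bdP i) (bd_idem bdP i) (bd_neq0 bdP i).
have I0 : #|I|%:R != 0 :> R.
  apply: contraTneq d0 => I0; have := block_type satG adP csJ tvG i.
  by rewrite I0 mul0r => /eqP; rewrite sqrf_eq0 => /eqP ->; rewrite ltxx.
move/(mulfI I0); case: eqP; case: eqP => // _ _ e; exfalso; lra.
Qed.

Section Intertwiner.
Variable i : 'I_s.
Hypothesis sqr : forall b, exists e : R, [/\ e * e = 1, x b *m x b *m P i = e *: P i &
  x' b *m x' b *m P i = e *: P i].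

(** A common eigenvector M of the involutions X |-> x'_b X x_b^T intertwines the two
    families up to signs.  Some element c of G commutes with the x_b up to these
    same signs, and M c is an intertwiner.  On a complex block M is first made
    linear or antilinear for the two complex structures. *)
Lemma exists_intertwiner : exists T (d : R), [/\ T != 0, d * d = 1 /\ J' i *m T = d *: (T *m J i),
  P i *m T = T, T *m P i = T & forall b, x' b *m T = T *m x b].
Proof.
have Gx b := gen_in gx b; have Gx' b := gen_in gx' b.
have Px b : P i *m x b = x b *m P i by rewrite (ad_com adP).
have Pxt b : P i *m (x b)^T = (x b)^T *m P i by rewrite (ad_com adP)//; exact: sat_tr.
have Px' b : P i *m x' b = x' b *m P i by rewrite (ad_com adP').
have Jxt b : J i *m (x b)^T = (x b)^T *m J i by rewrite (cs_com csJ)//; exact: sat_tr.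
have Jx' b : J' i *m x' b = x' b *m J' i by rewrite (cs_com csJ').
have [M0 [d [M00 [dd JM0 PM0 MP0]]]] : exists M0 (d : R), M0 != 0 /\ [/\ d * d = 1,
    J' i *m M0 = d *: (M0 *m J i), P i *m M0 = M0 & M0 *m P i = M0].
  have [J0|J0] := eqVneq (J i) 0.
    have /eqP J'0 : J' i == 0 by rewrite -same_type J0.
    exists (P i), 1; rewrite J0 J'0 mul0mx mulmx0 scaler0 mulr1 (bd_idem bdP); split=> //.
    exact: bd_neq0.
  have J'0 : J' i != 0 by rewrite -same_type.
  have JJ : J i *m J i = - P i.
    by case: (cs_sqr csJ i) => // Ji0; rewrite Ji0 eqxx in J0.
  have JJ' : J' i *m J' i = - P i.
    by case: (cs_sqr csJ' i) => // Ji0; rewrite Ji0 eqxx in J'0.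
  have JPr := cs_blockr bdP csJ i; have JPl := cs_block csJ i.
  have JPr' := cs_blockr bdP csJ' i; have JPl' := cs_block csJ' i.
  have [e|ne] := eqVneq (P i - J' i *m J i) 0; last first.
    exists (P i - J' i *m J i), 1; split=> //; rewrite mulr1 scale1r.
    rewrite !mulmxBr !mulmxBl !mulmxA JJ' JPl JPr' JPl' (bd_idem bdP) -!mulmxA JJ JPr.
    by split=> //; rewrite mulmxN !mulNmx JPl JPr' !opprK addrC.
  exists (P i + J' i *m J i), (-1); split.
    have : P i + P i != 0.
      by rewrite -mulr2n -scaler_nat scaler_eq0 pnatr_eq0 /= bd_neq0.
    by apply: contra_neq => e2; rewrite -[RHS]addr0 -{1}e2 -e addrACA subrr addr0.
  rewrite mulrNN mulr1 scaleN1r.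
  rewrite !mulmxDr !mulmxDl !mulmxA JJ' JPl JPr' JPl' (bd_idem bdP) -!mulmxA JJ JPr.
  by split=> //; rewrite mulmxN !mulNmx JPl JPr' opprD opprK addrC.
pose K : set 'M[R]_n := [set M | [/\ J' i *m M = d *: (M *m J i), P i *m M = M & M *m P i = M]].
have [||||||M [eps [[JM PM MP] Mn0 HM]]] := @conj_eigenvector x x' K M0.
- move=> X Y [h1 h2 h3] [h4 h5 h6]; split; rewrite ?mulmxDr ?mulmxDl ?h2 ?h3 ?h5 ?h6 ?h1 ?h4//.
  by rewrite scalerDr.
- move=> b X [h1 h2 h3]; split.
  + by rewrite !mulmxA Jx' -(mulmxA _ (J' i)) h1 -scalemxAr -scalemxAl -!mulmxA Jxt.
  + by rewrite !mulmxA Px' -(mulmxA _ (P i)) h2.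
  + by rewrite -!mulmxA -Pxt (mulmxA X) h3.
- move=> b X [h1 h2 h3]; have [e [ee e1 e2]] := sqr b.
  have -> : x' b *m (x' b *m X *m (x b)^T) *m (x b)^T =
     (x' b *m x' b *m P i) *m X *m (x b *m x b *m P i)^T.
    rewrite !trmx_mul (bd_sym bdP) -!mulmxA.
    by rewrite [in RHS](mulmxA (P i) X) h2 [in RHS](mulmxA X (P i)) h3.
  by rewrite e1 e2 trmxZ (bd_sym bdP) -!scalemxAl -!scalemxAr scalerA ee scale1r h2.
- move=> b c X _.
  have L u v : x' u *m (x' v *m X *m (x v)^T) *m (x u)^T =
    (x' u *m x' v) *m X *m (x u *m x v)^T by rewrite trmx_mul !mulmxA.
  rewrite !L; have [[-> ->]//|[-> ->]] := xx' b c.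
  by rewrite linearN/= mulmxN !mulNmx opprK.
- by [].
- by [].
have [c Gc Hc] := sepx eps.
have cc := sat_orthV satG Gc; have cc' := sat_orth satG Gc.
exists (M *m c), d; split.
- by apply: contra_neq Mn0 => Mc0; rewrite -[M]mulmx1 -cc' mulmxA Mc0 mul0mx.
- split=> //; rewrite mulmxA JM -scalemxAl -!mulmxA; congr (_ *: (_ *m _)).
  by rewrite (cs_com csJ).
- by rewrite mulmxA PM.
- by rewrite -mulmxA (ad_com adP i Gc) mulmxA MP.
move=> b; rewrite mulmxA.
have -> : x' b *m M = (-1) ^+ eps b *: (M *m x b).
  by rewrite scalemxAl -HM -(mulmxA _ (x b)^T) (sat_orthV satG (Gx b)) mulmx1.
rewrite -scalemxAl -mulmxA -mulmxA Hc -scalemxAr //.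
Qed.

(** Schur: for an intertwiner T, the matrices T^T T and T T^T are positive scalars, so
    that T becomes an isometry of the block after rescaling. *)
Lemma exists_block_isometry : exists U (d : R), [/\ U^T *m U = P i, U *m U^T = P i,
  P i *m U = U /\ U *m P i = U, d * d = 1 /\ J' i *m U = d *: (U *m J i) &
  forall b, x' b *m U = U *m x b].
Proof.
have [T [d [T0 [dd JT] PT TP xT]]] := exists_intertwiner.
have tTP : T^T *m P i = T^T by rewrite -[in RHS]PT trmx_mul (bd_sym bdP).
have PtT : P i *m T^T = T^T by rewrite -[in RHS]TP trmx_mul (bd_sym bdP).
have xtT b : x b *m T^T = T^T *m x' b.
  have e : (x b)^T *m T^T = T^T *m (x' b)^T by rewrite -!trmx_mul xT.
  rewrite -[LHS]mulmx1 -(sat_orthV satG' (gen_in gx' b)) -mulmxA (mulmxA T^T) -e.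
  by rewrite !mulmxA (sat_orth satG (gen_in gx b)) mul1mx.
have JtT : J i *m T^T = d *: (T^T *m J' i).
  have : (J' i *m T)^T = (d *: (T *m J i))^T by rewrite JT.
  rewrite trmxZ !trmx_mul (cs_skew csJ) (cs_skew csJ') mulmxN mulNmx scalerN => /oppr_inj ->.
  by rewrite scalerA dd scale1r.
have [c Wc] : exists c, T^T *m T = c *: P i.
  apply: (generated_scalar satG adP csJ tvG gx).
  - by rewrite trmx_mul trmxK.
  - by rewrite mulmxA PtT.
  - by rewrite mulmxA JtT -scalemxAl -!mulmxA JT -scalemxAr scalerA dd scale1r.
  - by move=> b; rewrite mulmxA xtT -!mulmxA xT.
have [c' Wc'] : exists c, T *m T^T = c *: P i.
  apply: (generated_scalar satG' adP' csJ' tvG' gx').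
  - by rewrite trmx_mul trmxK.
  - by rewrite mulmxA PT.
  - by rewrite mulmxA JT -scalemxAl -!mulmxA JtT -scalemxAr scalerA dd scale1r.
  - by move=> b; rewrite mulmxA xT -!mulmxA xtT.
have cc' : c' = c.
  have : (c' - c) *: T = 0.
    by rewrite scalerBl -{1}PT scalemxAl -Wc' -mulmxA Wc -scalemxAr TP subrr.
  by move/eqP; rewrite scaler_eq0 (negPf T0) orbF subr_eq0 => /eqP.
have c0 : 0 < c.
  have := mxtr_sqr_ge0 T; rewrite Wc mxtraceZ.
  have d0 := mxtr_gt0 (bd_sym bdP i) (bd_idem bdP i) (bd_neq0 bdP i).
  rewrite pmulr_lge0// le_eqVlt => /orP[/eqP c0|//].
  by move/eqP: T0; case; apply: mxtr_sqr_eq0; rewrite Wc -c0 scale0r mxtrace0.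
have nn : (Num.sqrt c)^-1 * (Num.sqrt c)^-1 * c = 1.
  by rewrite -invfM -expr2 sqr_sqrtr ?ltW// mulVf// gt_eqF.
exists ((Num.sqrt c)^-1 *: T), d; split.
- by rewrite trmxZ -scalemxAl -scalemxAr scalerA Wc scalerA nn scale1r.
- by rewrite trmxZ -scalemxAl -scalemxAr scalerA Wc' cc' scalerA nn scale1r.
- by rewrite -scalemxAl -scalemxAr PT TP.
- by split=> //; rewrite -scalemxAl -scalemxAr JT !scalerA mulrC.
- by move=> b; rewrite -scalemxAl -scalemxAr xT.
Qed.
End Intertwiner.
End TwoGroups.

(** By generation it is enough to conjugate the x_b, which is the intertwining
    property, and the centre.  A central z is a product b w, where w carries the
    phases of z on the complex blocks and b is an involution of the centre.
    Conjugation by V fixes b, which is scalar on every block, and turns w into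
    the central element of G' with the same phases, up to complex conjugation. *)
Lemma conj_incl (G G' : set 'M[R]_n) (J J' : 'I_s -> 'M[R]_n) (x x' : 'I_m -> 'M[R]_n)
    (U : 'I_s -> 'M[R]_n) (d : 'I_s -> R) :
  saturated G -> adapted G P -> complex_structures G P J -> generating G x ->
  saturated G' -> adapted G' P -> complex_structures G' P J' -> (forall b, G' (x' b)) ->
  (forall b, involutive_centre G b -> G' b) ->
  (forall i, [/\ (U i)^T *m U i = P i, U i *m (U i)^T = P i,
     P i *m U i = U i /\ U i *m P i = U i,
     d i * d i = 1 /\ J' i *m U i = d i *: (U i *m J i) &
     forall b, x' b *m U i = U i *m x b]) ->
  forall g, G g -> G' ((\sum_i U i) *m g *m (\sum_i U i)^T).
Proof.
move=> satG adP csJ gx satG' adP' csJ' Gx' BB' HU.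
set V := \sum_i U i.
have UP i : U i *m P i = U i by have [_ _ []] := HU i.
have PU i : P i *m U i = U i by have [_ _ []] := HU i.
have VP i : V *m P i = U i.
  rewrite /V mulmx_suml (bigD1 i)//= UP big1 ?addr0// => j ji.
  by rewrite -UP -mulmxA (bd_orth bdP ji) mulmx0.
have PV i : P i *m V = U i.
  rewrite /V mulmx_sumr (bigD1 i)//= PU big1 ?addr0// => j ji.
  by rewrite -PU mulmxA (bd_orth bdP) ?mul0mx// eq_sym.
have VtP i : V^T *m P i = (U i)^T by rewrite -[in LHS](bd_sym bdP) -trmx_mul PV.
have UtP i : (U i)^T *m P i = (U i)^T by rewrite -[in LHS](bd_sym bdP) -trmx_mul PU.
have VV : V *m V^T = 1%:M.
  apply: (mx_block_ext bdP) => i; rewrite -mulmxA VtP mul1mx -(PU i).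
  rewrite trmx_mul (bd_sym bdP).
  have -> : V *m ((U i)^T *m P i) = (V *m P i) *m (U i)^T.
    by rewrite UtP -mulmxA; congr (_ *m _); rewrite -[in RHS](bd_sym bdP) -trmx_mul UP.
  by rewrite VP; have [_ -> _ _ _] := HU i.
have VtV : V^T *m V = 1%:M by exact: mulmx1C.
have xV b : x' b *m V = V *m x b.
  rewrite /V mulmx_sumr mulmx_suml; apply: eq_bigr => i _.
  by have [_ _ _ _] := HU i.
apply: (gen_ind gx (H := [set g | G' (V *m g *m V^T)])) => /=.
- move=> g h Gg Gh; suff -> : V *m (g *m h) *m V^T = (V *m g *m V^T) *m (V *m h *m V^T).
    exact: sat_M.
  by rewrite !mulmxA -(mulmxA _ V^T V) VtV mulmx1.
- move=> z cz; have [c [t Hct]] := centre_block bdP satG adP csJ cz.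
  have ct i : c i ^+ 2 + t i ^+ 2 = 1 by case: (Hct i).
  have zP i : z *m P i = c i *: P i + t i *: J i by case: (Hct i).
  have [w cw wP] := exists_phases bdP satG csJ ct.
  have dt2 i : c i ^+ 2 + (d i * t i) ^+ 2 = 1.
    by have [_ _ _ [dd _] _] := HU i; rewrite exprMn [d i ^+ 2]expr2 dd mul1r.
  have [w' cw' wP'] := exists_phases bdP satG' csJ' dt2.
  pose b := z *m w^T; pose e i := if J i == 0 then c i else 1.
  have zbw : z = b *m w by rewrite -mulmxA (sat_orthV satG cw.1) mulmx1.
  have cb : centre G b by apply: centreM => //; exact: centreT.
  have bP i : b *m P i = e i *: P i.
    have Pw : P i *m w = w *m P i by rewrite (ad_com adP i cw.1).
    have Pz : P i *m z = z *m P i by rewrite (ad_com adP i cz.1).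
    have -> : b *m P i = z *m (w *m P i)^T by rewrite -Pw trmx_mul (bd_sym bdP) mulmxA.
    rewrite wP /e; case: eqVneq => Ji.
      by rewrite Ji mulmx0 !scaler0 !addr0 (bd_sym bdP) zP Ji scaler0 addr0.
    have JJ : J i *m J i = - P i by case: (cs_sqr csJ i) => // J0; rewrite J0 eqxx in Ji.
    rewrite phase_block// -zP trmx_mul (bd_sym bdP) mulmxA -Pz -mulmxA (sat_orth satG cz.1).
    by rewrite mulmx1 scale1r.
  have binv : involutive_centre G b.
    split=> //; apply: (mx_block_ext bdP) => i.
    rewrite -mulmxA bP -scalemxAr bP scalerA mul1mx /e; case: eqVneq => Ji.
      have [+ _ /(_ Ji) t0] := Hct i.
      by rewrite t0 expr0n addr0 expr2 => ->; rewrite scale1r.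
    by rewrite mulr1 scale1r.
  clearbody b; have Vb : V *m b = b *m V.
    apply: (mx_block_ext bdP) => i.
    by rewrite -!mulmxA bP -scalemxAr !VP -(PU i) (mulmxA b) bP -scalemxAl.
  have Vw : V *m w = w' *m V.
    apply: (mx_block_ext bdP) => i; have [_ _ _ [dd JU] _] := HU i.
    have VJ : V *m J i = U i *m J i by rewrite -[in LHS](cs_block csJ i) mulmxA VP.
    have JJU : J' i *m J' i *m U i = U i *m (J i *m J i).
      by rewrite -mulmxA JU -scalemxAr (mulmxA (J' i)) JU -scalemxAl scalerA dd scale1r mulmxA.
    have -> : w' *m V *m P i = w' *m P i *m U i by rewrite -!mulmxA VP PU.
    rewrite -mulmxA wP wP' !mulmxDr !mulmxDl VP PU -!scalemxAr -!scalemxAl.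
    by rewrite JJU JU scalerA mulrAC dd mul1r !mulmxA VJ.
  have -> : V *m z *m V^T = b *m w'.
    by rewrite zbw mulmxA Vb -(mulmxA b) Vw -!mulmxA VV mulmx1.
  by apply: (sat_M satG'); [exact: BB'|exact: cw'.1].
move=> b; rewrite -xV -mulmxA VV mulmx1; exact: Gx'.
Qed.

Lemma generating_twist G (x z : 'I_m -> 'M[R]_n) : saturated G -> generating G x ->
  (forall b, centre G (z b)) -> generating G (fun b => z b *m x b).
Proof.
move=> satG gx cz; split=> [b|H HM Hc Hx].
  exact: (sat_M satG (cz b).1 (gen_in gx b)).
apply: (gen_ind gx) => // b.
have -> : x b = (z b)^T *m (z b *m x b) by rewrite mulmxA (sat_orthV satG (cz b).1) mul1mx.
by apply: HM; [exact: Hc _ (centreT satG (cz b))|exact: Hx].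
Qed.

Lemma twist_mul G z w g h : centre G z -> centre G w -> G g -> G h ->
  (z *m g) *m (w *m h) = z *m w *m (g *m h).
Proof.
move=> cz cw Gg Gh; rewrite -!mulmxA; congr (_ *m _).
by rewrite !mulmxA (cw.2 _ Gg).
Qed.

(** Adjust the generators by central elements so that their squares are 1 on the complex
    blocks; on the real blocks the squares are the given signs.  Then glue
    the isometries of the blocks. *)
Theorem conj_of_matching (G G' : set 'M[R]_n) (a a' : I -> 'M[R]_n) (x x' : 'I_m -> 'M[R]_n) :
  saturated G -> saturated G' -> adapted G P -> adapted G' P ->
  transversal G a -> transversal G' a' -> generating G x -> generating G' x' ->
  commute_alike x x' -> separating G x ->
  (forall b, involutive_centre G b <-> involutive_centre G' b) ->
  (forall i, (\tr (P i)) ^+ 2 = #|I|%:R -> forall b (e e' : R), e = 1 \/ e = -1 ->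
    e' = 1 \/ e' = -1 -> x b *m x b *m P i = e *: P i ->
    x' b *m x' b *m P i = e' *: P i -> e = e') ->
  exists2 V : 'M[R]_n, V *m V^T = 1%:M & forall g, G g <-> G' (V *m g *m V^T).
Proof.
move=> satG satG' adP adP' tvG tvG' gx gx' xx' sepx BB' sqr.
have [J csJ] := exists_complex_structures satG bdP adP.
have [J' csJ'] := exists_complex_structures satG' bdP adP'.
have Gx b := gen_in gx b; have Gx' b := gen_in gx' b.
have JJ' := same_type satG adP csJ tvG satG' adP' csJ' tvG'.
have /choice[z Hz] b : exists z, centre G z /\ forall i,
  (J i = 0 -> (z *m x b) *m (z *m x b) *m P i = x b *m x b *m P i) /\
  (J i != 0 -> (z *m x b) *m (z *m x b) *m P i = P i).
  by have [z cz zP] := exists_unit_square satG adP csJ (Gx b); exists z.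
have /choice[z' Hz'] b : exists z, centre G' z /\ forall i,
  (J' i = 0 -> (z *m x' b) *m (z *m x' b) *m P i = x' b *m x' b *m P i) /\
  (J' i != 0 -> (z *m x' b) *m (z *m x' b) *m P i = P i).
  by have [z0 cz zP] := exists_unit_square satG' adP' csJ' (Gx' b); exists z0.
have cz b : centre G (z b) by case: (Hz b).
have cz' b : centre G' (z' b) by case: (Hz' b).
pose y b := z b *m x b; pose y' b := z' b *m x' b.
have gy : generating G y := generating_twist satG gx cz.
have gy' : generating G' y' := generating_twist satG' gx' cz'.
have yy' : commute_alike y y'.
  move=> b c; rewrite /y /y'.
  rewrite (twist_mul (cz b) (cz c) (Gx b) (Gx c)) (twist_mul (cz c) (cz b) (Gx c) (Gx b)).
  rewrite (twist_mul (cz' b) (cz' c) (Gx' b) (Gx' c)) (twist_mul (cz' c) (cz' b) (Gx' c) (Gx' b)).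
  have -> : z b *m z c = z c *m z b by rewrite ((cz c).2 _ (cz b).1).
  have -> : z' b *m z' c = z' c *m z' b by rewrite ((cz' c).2 _ (cz' b).1).
  by have [[-> ->]|[-> ->]] := xx' b c; [left|right]; rewrite ?mulmxN.
have sepy : separating G y.
  move=> eps; have [c Gc Hc] := sepx eps; exists c => // b.
  by rewrite /y mulmxA ((cz b).2 _ Gc) -mulmxA Hc -scalemxAr !mulmxA.
have sqy i b : exists e : R, [/\ e * e = 1, y b *m y b *m P i = e *: P i &
    y' b *m y' b *m P i = e *: P i].
  have [_ /(_ i)[h1 h2]] := Hz b; have [_ /(_ i)[h1' h2']] := Hz' b.
  have [Ji|Ji] := eqVneq (J i) 0; last first.
    by exists 1; rewrite scale1r mulr1; split=> //; [exact: h2|apply: h2'; rewrite -JJ'].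
  have J'i : J' i = 0 by apply/eqP; rewrite -JJ' Ji.
  have sign (e : R) : e * e = 1 -> e = 1 \/ e = -1.
    by move=> /eqP; rewrite -expr2 sqrf_eq1 => /orP[]/eqP ->; [left|right].
  have [e [t [ct sq t0]]] := centre_block1 satG adP csJ i (centre_sqr satG (Gx b)).
  have ee : e * e = 1 by move: ct; rewrite (t0 Ji) expr0n addr0 expr2.
  have {}sq : x b *m x b *m P i = e *: P i by rewrite sq Ji scaler0 addr0.
  have [e' [t' [ct' sq' t0']]] := centre_block1 satG' adP' csJ' i (centre_sqr satG' (Gx' b)).
  have ee' : e' * e' = 1 by move: ct'; rewrite (t0' J'i) expr0n addr0 expr2.
  have {}sq' : x' b *m x' b *m P i = e' *: P i by rewrite sq' J'i scaler0 addr0.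
  exists e; split=> //; first by rewrite /y h1.
  rewrite /y' h1'// sq'; congr (_ *: _); apply/esym.
  apply: (sqr i _ b) => //; [|exact: sign|exact: sign].
  by rewrite (block_type satG adP csJ tvG) Ji eqxx mulr1.
have /choice[Ud HU] i : exists Ud : 'M[R]_n * R, [/\ Ud.1^T *m Ud.1 = P i, Ud.1 *m Ud.1^T = P i,
  P i *m Ud.1 = Ud.1 /\ Ud.1 *m P i = Ud.1,
  Ud.2 * Ud.2 = 1 /\ J' i *m Ud.1 = Ud.2 *: (Ud.1 *m J i) &
  forall b, y' b *m Ud.1 = Ud.1 *m y b].
  have [U [d HU]] := exists_block_isometry satG adP csJ tvG gy
    satG' adP' csJ' tvG' gy' yy' sepy (sqy i).
  by exists (U, d).
pose U i := (Ud i).1; pose d i := (Ud i).2.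
have incl := conj_incl satG adP csJ gy satG' adP' csJ' (gen_in gy')
  (fun b hb => ((BB' b).1 hb).1.1) HU.
have HU' i : [/\ ((U i)^T)^T *m (U i)^T = P i, (U i)^T *m ((U i)^T)^T = P i,
     P i *m (U i)^T = (U i)^T /\ (U i)^T *m P i = (U i)^T,
     d i * d i = 1 /\ J i *m (U i)^T = d i *: ((U i)^T *m J' i) &
     forall b, y b *m (U i)^T = (U i)^T *m y' b].
  have [h1 h2 [h3 h4] [dd h5] h6] := HU i; rewrite trmxK; split=> //.
  - by split; apply: trmx_inj; rewrite trmx_mul trmxK (bd_sym bdP).
  - split=> //; have : (J' i *m U i)^T = (d i *: (U i *m J i))^T by rewrite h5.
    rewrite trmxZ !trmx_mul (cs_skew csJ) (cs_skew csJ') mulmxN mulNmx scalerN => /oppr_inj ->.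
    by rewrite scalerA dd scale1r.
  - move=> b; have Gy := gen_in gy b; have Gy' := gen_in gy' b.
    have e : (y b)^T *m (U i)^T = (U i)^T *m (y' b)^T by rewrite -!trmx_mul h6.
    rewrite -[LHS]mulmx1 -(sat_orthV satG' Gy') -mulmxA (mulmxA (U i)^T) -e.
    by rewrite !mulmxA (sat_orth satG Gy) mul1mx.
have incl' := conj_incl satG' adP' csJ' gy' satG adP csJ (gen_in gy)
  (fun b hb => ((BB' b).2 hb).1.1) HU'.
have VV : (\sum_i U i) *m (\sum_i U i)^T = 1%:M.
  rewrite linear_sum/= mulmx_suml -(bd_sum bdP); apply: eq_bigr => i _.
  rewrite mulmx_sumr (bigD1 i)//= big1 ?addr0 => [|j ji]; first by case: (HU i).
  have [_ _ [_ h4] _ _] := HU i; have [_ _ [h3 _] _ _] := HU' j.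
  by rewrite -[U i]h4 -[(U j)^T]h3 -mulmxA (mulmxA (P i)) (bd_orth bdP) 1?eq_sym// mul0mx mulmx0.
have VV' := mulmx1C VV.
exists (\sum_i U i) => // g; split=> [|/incl']; first exact: incl.
rewrite -linear_sum/= trmxK; set V := \sum_i U i.
by rewrite -!mulmxA VV' mulmx1 mulmxA VV' mul1mx.
Qed.

(** Modulo the centre, an element of G is determined by its commutation signs with the
    x b, because these generate; hence the 2 ^ m elements of the transversal
    realize all the 2 ^ m sign vectors. *)
Lemma separating_of_card G (a : I -> 'M[R]_n) (x : 'I_m -> 'M[R]_n) : saturated G ->
  transversal G a -> generating G x -> #|I| = (2 ^ m)%N -> separating G x.
Proof.
move=> satG tvG gx cardI eps.
pose theta i := [ffun b => `[< a i *m x b != x b *m a i >]].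
have thetaP i b : a i *m x b = (-1) ^+ theta i b *: (x b *m a i).
  rewrite ffunE; case: asboolP => [/eqP ne|/negP/negPn/eqP ->]; last by rewrite scale1r.
  have [//|->] := sat_comm satG (tv_in tvG i) (gen_in gx b).
  by rewrite expr1 scaleN1r.
have theta_inj : injective theta.
  move=> i j tij.
  have c_x b : x b *m (a i *m (a j)^T) = (a i *m (a j)^T) *m x b.
    have hi : x b *m a i = (-1) ^+ theta i b *: (a i *m x b).
      by rewrite thetaP scalerA -exprMn mulrNN mulr1 expr1n scale1r.
    have hj : (a j)^T *m x b = (-1) ^+ theta j b *: (x b *m (a j)^T).
      rewrite -[LHS]mulmx1 -(sat_orth satG (tv_in tvG j)) !mulmxA -(mulmxA _ (x b)).
      have -> : x b *m a j = (-1) ^+ theta j b *: (a j *m x b).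
        by rewrite thetaP scalerA -exprMn mulrNN mulr1 expr1n scale1r.
      by rewrite -scalemxAr -scalemxAl mulmxA (sat_orthV satG (tv_in tvG j)) mul1mx.
    by rewrite mulmxA hi -[RHS]mulmxA hj tij -scalemxAl -scalemxAr mulmxA.
  have Gij : G (a i *m (a j)^T).
    by apply: (sat_M satG); [exact: (tv_in tvG)|exact: (sat_tr satG (tv_in tvG j))].
  apply: (tv_uniq tvG (z := a i *m (a j)^T)); last first.
    by rewrite -mulmxA (sat_orthV satG (tv_in tvG j)) mulmx1.
  split=> //; apply: (gen_ind gx (H := [set g |
    g *m (a i *m (a j)^T) = (a i *m (a j)^T) *m g])) => /=.
  - by move=> g h hg hh; rewrite -mulmxA hh mulmxA hg mulmxA.
  - by move=> z cz; rewrite (cz.2 _ Gij).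
  - exact: c_x.
have [inv _ thetaK] : bijective theta.
  by apply: inj_card_bij => //; rewrite card_ffun card_bool card_ord cardI.
exists (a (inv [ffun b => eps b])); first exact: (tv_in tvG).
by move=> b; rewrite thetaP thetaK ffunE.
Qed.
End Matching.

(** * The matrix exponential *)

Section MatrixExponential.
Variables (R : realType) (n : nat).
Implicit Types X Y J : 'M[R]_n.

Lemma cvg_mx_coord (u : nat -> 'M[R]_n) (L : 'M[R]_n) :
  (forall i j, (fun k => u k i j) @ \oo --> L i j) -> u @ \oo --> L.
Proof.
move=> uL; apply/cvg_mx_entourageP => E entE.
have h (i j : 'I_n) : \forall k \near \oo, (L i j, u k i j) \in E.
  have H : \forall k \near \oo, E (L i j, u k i j).
    by have /cvg_entourageP/(_ _ entE) := uL i j.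
  by apply: (filterS _ H) => k /= /mem_set.
have h' (i : 'I_n) := @filter_forall _ _ _ _ eventually_filter (h i).
by have := @filter_forall _ _ _ _ eventually_filter h'.
Qed.

(** The maximal row sum is submultiplicative. *)
Lemma mxpow_bound X (M : R) : (forall i, \sum_j `|X i j| <= M) -> 0 <= M ->
  forall k i j, `|(X ^+ k) i j| <= M ^+ k.
Proof.
move=> XM M0; elim=> [|k IH] i j.
  rewrite !expr0 /GRing.one/= mxE; case: eqP => _; rewrite ?mulr1n ?mulr0n ?normr1 ?normr0 //.
rewrite !exprS mxE; apply: le_trans (ler_norm_sum _ _ _) _.
apply: le_trans (_ : \sum_l `|X i l| * M ^+ k <= _).
  by apply: ler_sum => l _; rewrite normrM ler_wpM2l.
by rewrite -mulr_suml ler_wpM2r ?exprn_ge0.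
Qed.

Definition expmx_coeff X k := (k`!%:R)^-1 *: X ^+ k.

Definition mx_bound X : R := \sum_i \sum_j `|X i j|.

Lemma mx_bound_ge0 X : 0 <= mx_bound X.
Proof. by apply: sumr_ge0 => i _; apply: sumr_ge0. Qed.

Lemma mx_boundP X i : \sum_j `|X i j| <= mx_bound X.
Proof.
rewrite /mx_bound [leRHS](bigD1 i)//= lerDl; apply: sumr_ge0 => l _; exact: sumr_ge0.
Qed.

Lemma mx_boundZ t X : mx_bound (t *: X) = `|t| * mx_bound X.
Proof.
rewrite /mx_bound mulr_sumr; apply: eq_bigr => i _; rewrite mulr_sumr.
by apply: eq_bigr => j _; rewrite mxE normrM.
Qed.

Lemma expmx_coeff_bound X k i j :
  `|expmx_coeff X k i j| <= exp_coeff (mx_bound X) k.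
Proof.
rewrite /expmx_coeff mxE normrM ger0_norm ?invr_ge0 ?ler0n//.
rewrite /exp_coeff/= mulrC ler_wpM2r ?invr_ge0 ?ler0n//.
by apply: mxpow_bound => [l|]; [exact: mx_boundP|exact: mx_bound_ge0].
Qed.

Lemma expmx_coord_cvg X i j :
  (fun N => \sum_(0 <= k < N) expmx_coeff X k i j) @ \oo --> expmx X i j.
Proof.
have cv p q : cvgn (series (fun k => expmx_coeff X k p q)).
  apply: normed_cvg; apply: series_le_cvg (is_cvg_series_exp_coeff (mx_bound X)) => k //=.
    by rewrite exp_coeff_ge0// mx_bound_ge0.
  exact: expmx_coeff_bound.
have : series (expmx_coeff X) @ \oo -->
    \matrix_(p, q) limn (series (fun k => expmx_coeff X k p q)).
  apply: cvg_mx_coord => p q; rewrite mxE.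
  rewrite (_ : (fun _ => _) = series (fun k => expmx_coeff X k p q)); first exact: cv.
  by apply/funext => N; rewrite /series/= summxE.
move=> /cvg_lim E; rewrite /expmx -/(expmx_coeff X) E ?mxE; first exact: cv.
exact: norm_hausdorff.
Qed.

Lemma series_exp_coeff_le (x : R) N : 0 <= x -> series (exp_coeff x) N <= expR x.
Proof.
move=> x0; rewrite /expR; apply: nondecreasing_cvgn_le.
  by apply/nondecreasing_seqP => k; rewrite seriesSr lerDl exp_coeff_ge0.
exact: is_cvg_series_exp_coeff.
Qed.

(** Entrywise, the terms of degree at least 2 are bounded by those of t^2 exp (mx_bound X). *)
Lemma expmx_expand X : exists2 C : R, 0 <= C & forall t, `|t| <= 1 -> forall i j,
  `|(expmx (t *: X) - (1%:M + t *: X)) i j| <= C * t ^+ 2.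
Proof.
exists (expR (mx_bound X)); first exact: expR_ge0.
move=> t t1 i j; set E := expmx _; set L := (1%:M + _).
have : (fun N => `|\sum_(0 <= k < N) expmx_coeff (t *: X) k i j - L i j|) @ \oo -->
    `|E i j - L i j|.
  by apply: cvg_norm; apply: cvgB; [exact: expmx_coord_cvg|exact: cvg_cst].
move=> /cvgr_to_le H; rewrite [(E - L) i j]mxE [(- L) i j]mxE; apply: H.
near=> N.
have N2 : (2 <= N)%N by near: N; exists 2%N.
rewrite big_ltn; last exact: ltn_trans N2.
rewrite big_ltn //.
have -> : L i j = expmx_coeff (t *: X) 0 i j + expmx_coeff (t *: X) 1 i j.
  by rewrite /expmx_coeff expr0 expr1 fact0 invr1 !scale1r /L [LHS]mxE.
rewrite addrA [X in `|X|]addrAC subrr add0r.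
apply: le_trans (ler_norm_sum _ _ _) _.
apply: (@le_trans _ _ (\sum_(2 <= k < N) exp_coeff (mx_bound X) k * t ^+ 2)).
  rewrite big_nat_cond [leRHS]big_nat_cond; apply: ler_sum => k; rewrite andbT => /andP[k2 _].
  apply: le_trans (expmx_coeff_bound _ _ _ _) _.
  rewrite mx_boundZ /exp_coeff/= exprMn -[leLHS]mulrA [leLHS]mulrC ler_wpM2l//.
    by rewrite divr_ge0 ?exprn_ge0// mx_bound_ge0.
  by rewrite -(subnK k2) exprD real_normK ?num_real// ler_piMl ?sqr_ge0// exprn_ile1.
rewrite -mulr_suml ler_wpM2r ?sqr_ge0//.
apply: le_trans (series_exp_coeff_le N (mx_bound_ge0 X)).
rewrite /series/= [leRHS](big_cat_nat (n:=2))//= lerDr.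
by apply: sumr_ge0 => k _; rewrite exp_coeff_ge0// mx_bound_ge0.
Unshelve. all: by end_near.
Qed.


Lemma linear_mx_bound (psi : {linear 'M[R]_n -> 'M[R]_n}) :
  exists2 K : R, 0 <= K & forall Y r, (forall i j, `|Y i j| <= r) ->
  forall i j, `|psi Y i j| <= K * r.
Proof.
exists (\sum_i \sum_j \sum_a \sum_b `|psi (delta_mx a b) i j|).
  by do 4!(apply: sumr_ge0 => ? _).
move=> Y r Yr i j; rewrite {1}(matrix_sum_delta Y) linear_sum summxE.
apply: le_trans (ler_norm_sum _ _ _) _.
have r0 : 0 <= r by apply: le_trans (Yr i j).
apply: (@le_trans _ _ ((\sum_a \sum_b `|psi (delta_mx a b) i j|) * r)).
  rewrite mulr_suml; apply: ler_sum => a _; rewrite linear_sum summxE mulr_suml.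
  apply: le_trans (ler_norm_sum _ _ _) _; apply: ler_sum => b _.
  by rewrite linearZ mxE normrM mulrC ler_wpM2l.
rewrite ler_wpM2r// [leRHS](bigD1 i)//= [X in _ <= X + _](bigD1 j)//= -addrA lerDl.
by rewrite addr_ge0//; do ?(apply: sumr_ge0 => ? _).
Qed.

Lemma affine_small_eq0 (x y C : R) : 0 <= C ->
  (forall e, 0 < e -> exists2 t, 0 < t < e & `|x + t * y| <= C * t ^+ 2) ->
  x = 0 /\ y = 0.
Proof.
move=> C0 H.
have x0 : x = 0.
  apply/eqP/negPn/negP; rewrite -normr_gt0 => xgt0.
  have D : 0 < `|y| + C + 1 by rewrite ltr_wpDl// addr_ge0.
  have [|t /andP[t0 te] Ht] := H (Num.min 1 (`|x| / (`|y| + C + 1))).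
    by rewrite lt_min ltr01 divr_gt0.
  move: te; rewrite lt_min ltr_pdivlMr// => /andP[t1 te].
  have : `|x| <= C * t ^+ 2 + t * `|y|.
    rewrite -[X in _ <= _ + X * _](gtr0_norm t0) -normrM.
    by rewrite -[x in leLHS](addrK (t * y)); apply: le_trans (ler_normB _ _) _; rewrite lerD2r.
  have : C * t ^+ 2 <= C * t by rewrite ler_wpM2l// expr2 ler_piMr// ltW.
  nra.
split=> //; apply/eqP/negPn/negP; rewrite -normr_gt0 => ygt0.
have D : 0 < C + 1 by rewrite ltr_wpDl.
have [|t /andP[t0 te]] := H (`|y| / (C + 1)); first by rewrite divr_gt0.
move: te; rewrite ltr_pdivlMr// => te.
rewrite x0 add0r normrM gtr0_norm// expr2 mulrCA ler_pM2l//; nra.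
Qed.

(** By expmx_expand, psi (exp (t X)) = psi 1 + t psi X + O(t^2); if this vanishes for
    arbitrarily small t > 0, then both coefficients are 0.  Asking only for
    arbitrarily small t allows for a commutation up to a sign depending on t. *)
Lemma expmx_freq_linear (psi : {linear 'M[R]_n -> 'M[R]_n}) X :
  (forall e, 0 < e -> exists2 t, 0 < t < e & psi (expmx (t *: X)) = 0) ->
  psi 1%:M = 0 /\ psi X = 0.
Proof.
move=> H; have [C C0 HC] := expmx_expand X; have [K K0 HK] := linear_mx_bound psi.
suff E i j : psi 1%:M i j = 0 /\ psi X i j = 0.
  by split; apply/matrixP => i j; rewrite mxE; case: (E i j).
apply: (@affine_small_eq0 _ _ (K * C)); first exact: mulr_ge0.
move=> e e0; have [|t /andP[t0]] := H (Num.min e 1); first by rewrite lt_min e0 ltr01.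
rewrite lt_min => /andP[te t1] Ht; exists t; first by rewrite t0 te.
have : `|psi (expmx (t *: X) - (1%:M + t *: X)) i j| <= K * (C * t ^+ 2).
  by apply: HK => p q; apply: HC; rewrite gtr0_norm// ltW.
by rewrite linearB Ht sub0r mxE normrN linearD linearZ /= [X in `|X|]mxE [X in _ + X]mxE mulrA.
Qed.

(** The powers of J are 1, J, J^2, - J, - J^2 and so on, which splits the exponential
    series into those of the sine and the cosine, with a correction of the
    constant term. *)
Lemma expmx_tripotent J t : J *m J *m J = - J ->
  expmx (t *: J) = 1%:M + sin t *: J + (1 - cos t) *: (J *m J).
Proof.
move=> J3.
have powS (Y : 'M[R]_n) m : Y ^+ m.+1 = Y *m Y ^+ m by rewrite exprS.
have Jpow m : J ^+ m.*2.+1 = (-1) ^+ m *: J.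
  elim: m => [|m IH]; first by rewrite expr1 scale1r.
  rewrite doubleS 2!powS IH -!scalemxAr mulmxA J3 exprS mulN1r scaleNr scalerN //.
have Zpow m : (t *: J) ^+ m = t ^+ m *: J ^+ m.
  elim: m => [|m IH]; first by rewrite !expr0 scale1r.
  by rewrite !powS IH -scalemxAr -scalemxAl scalerA exprS mulrC.
have coef k : expmx_coeff (t *: J) k = (k == 0)%:R *: (1%:M + J *m J)
    + sin_coeff t k *: J - cos_coeff t k *: (J *m J).
  rewrite /expmx_coeff Zpow scalerA /sin_coeff/cos_coeff /=.
  rewrite -(odd_double_half k); case: (odd k); rewrite ?add1n ?add0n.
    rewrite Jpow scalerA /= odd_double /= doubleK !mul0r !scale0r subr0 add0r.
    by congr (_ *: _); ring.
  case: (k./2) => [|m].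
    rewrite double0 /= -exprnP !expr0 !mul0r fact0 invr1 !mul1r !scale1r scale0r addr0.
    by rewrite addrK.
  rewrite doubleS powS Jpow /= odd_double/= scale0r add0r !mul0r scale0r add0r.
  rewrite -scalemxAr scalerA -scaleNr; congr (_ *: _).
  by rewrite -exprnP doubleK [(-1) ^+ m.+1]exprS; ring.
apply/matrixP => i j; have := @expmx_coord_cvg (t *: J) i j.
have -> : (fun N => \sum_(0 <= k < N) expmx_coeff (t *: J) k i j) =
   (fun N => (0 < N)%N%:R * (1%:M + J *m J) i j + series (sin_coeff t) N * J i j
     - series (cos_coeff t) N * (J *m J) i j).
  apply/funext => N; rewrite /series/= !mulr_suml.
  have -> : (0 < N)%N%:R * (1%:M + J *m J) i j =
      \sum_(0 <= k < N) (k == 0)%:R * (1%:M + J *m J) i j.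
    by case: N => [|N]; rewrite ?big_nil ?mul0r// big_nat_recl//=
      big1 ?addr0// => k _; rewrite mul0r.
  rewrite -big_split/= -sumrB; apply: eq_bigr => k _.
  by rewrite coef; move: (J *m J) => K; rewrite !mxE.
have -> : (1%:M + sin t *: J + (1 - cos t) *: (J *m J)) i j =
    (1%:M + J *m J) i j + sin t * J i j - cos t * (J *m J) i j.
  by move: (J *m J) => K; rewrite !mxE; ring.
move=> /(cvg_lim (@Rhausdorff R)) <-; apply: (cvg_lim (@Rhausdorff R)).
apply: cvgB; [apply: cvgD|].
- rewrite -cvg_shiftS /=; under eq_cvg do rewrite mul1r; exact: cvg_cst.
- apply: cvgMr_tmp; rewrite unlock; exact: is_cvg_series_sin_coeff.
- apply: cvgMr_tmp; rewrite unlock; exact: is_cvg_series_cos_coeff.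
Qed.

End MatrixExponential.

(** * Simultaneous eigenspaces of commuting involutions *)

Section Eigenprojections.
Variables (R : realType) (n : nat) (S : set (orthogonal_matrix R n)).
Hypothesis invS : forall A, S A -> omx A *m omx A = 1%:M.
Hypothesis comS : forall A B, S A -> S B -> omx A *m omx B = omx B *m omx A.

Lemma symS A : S A -> (omx A)^T = omx A.
Proof.
by move=> SA; rewrite -[LHS]mulmx1 -(invS SA) mulmxA otrmxM mul1mx.
Qed.

(** Take a nonzero stable subspace W of minimal dimension.  The fixed space of A in W is
    stable as well, so it is 0 or W, and A acts on W by -1 or 1. *)
Lemma simultaneous_eigenvectors (U : {vspace 'cV[R]_n}) : U != 0%VS ->
  (forall A w, S A -> w \in U -> omx A *m w \in U) ->
  exists2 u, u \in U /\ u != 0 & exists chi : orthogonal_matrix R n -> R,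
    forall A, S A -> omx A *m u = chi A *: u.
Proof.
move=> U0 SU.
pose Q d := `[< exists U' : {vspace 'cV[R]_n}, [/\ \dim U' = d, U' != 0%VS,
  (U' <= U)%VS & forall A w, S A -> w \in U' -> omx A *m w \in U'] >].
have exQ : exists d, Q d by exists (\dim U); apply/asboolP; exists U; split.
have [d /asboolP[W [dW W0 WU SW]] mind] := ex_minnP exQ.
have scal A : exists e : R, S A -> forall w, w \in W -> omx A *m w = e *: w.
  have [SA|nSA] := pselect (S A); last by exists 0.
  have [E HE] : exists E : {vspace 'cV[R]_n}, forall w, w \in E <->
      w \in W /\ omx A *m w = w.
    apply: linear_pred_vspace => [|c u w [uW uA] [wW wA]].
      by rewrite mem0v mulmx0.
    by rewrite memvD ?memvZ// mulmxDr -scalemxAr uA wA.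
  have [E0|En0] := eqVneq E 0%VS.
    exists (-1) => _ w wW; have : w + omx A *m w \in E.
      apply/HE; split; first by rewrite memvD// SW.
      by rewrite mulmxDr mulmxA invS// mul1mx addrC.
    by rewrite E0 memv0 addrC addr_eq0 scaleN1r => /eqP.
  exists 1 => _ w wW; rewrite scale1r.
  have EW : (E <= W)%VS by apply/subvP => v /HE[].
  have dE : (d <= \dim E)%N.
    apply: mind; apply/asboolP; exists E; split=> //; first exact: subv_trans WU.
    move=> B v SB /HE[vW vA]; apply/HE; split; first exact: SW.
    by rewrite mulmxA (comS SA SB) -mulmxA vA.
  have /eqP EWeq : E == W by rewrite eqEdim EW dW.
  by have := wW; rewrite -EWeq => /HE[].
have /choice[chi Hchi] := scal.
exists (vpick W); last by exists chi => A SA; rewrite Hchi// memv_pick.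
by rewrite vpick0 W0; split=> //; move/subvP: WU; apply; exact: memv_pick.
Qed.

Variables (s : nat) (V : 'I_s -> {vspace 'cV[R]_n}).
Hypothesis injV : injective V.
Hypothesis enumV : forall W, sim_eigenspace S W <-> exists i, V i = W.

(** Distinct eigenspaces have distinct characters, hence are orthogonal.  They fill the
    whole space because the orthogonal complement of their sum is stable: if it
    were nonzero, it would contain a simultaneous eigenvector. *)
Lemma eigenprojections : exists P : 'I_s -> 'M[R]_n, [/\ block_decomposition P,
  forall i w, w \in V i <-> P i *m w = w, forall i, \tr (P i) = (\dim (V i))%:R &
  forall i A, S A -> exists e : R, omx A *m P i = e *: P i].
Proof.
have /choice[P HP] i := orthogonal_projection (V i).
have Psym i : (P i)^T = P i by case: (HP i).
have PP i : P i *m P i = P i by case: (HP i).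
have VP i w : w \in V i <-> P i *m w = w by case: (HP i).
have Vsim i : sim_eigenspace S (V i) by apply/enumV; exists i.
have /choice[chi Hchi] i : exists chi, forall v, v \in V i <->
    (forall A, S A -> omx A *m v = chi A *: v) by case: (Vsim i).
have AP i A : S A -> omx A *m P i = chi i A *: P i.
  move=> SA; apply/matrixP => p q.
  have : omx A *m col q (P i) = chi i A *: col q (P i).
    by apply: (Hchi i _).1 SA; apply/VP; rewrite mulmx_col PP.
  by rewrite mulmx_col => /colP/(_ p); rewrite !mxE.
have PA i A : S A -> P i *m omx A = chi i A *: P i.
  by move=> SA; apply: trmx_inj; rewrite trmx_mul Psym symS// AP// trmxZ Psym.
have orth i j : i != j -> P i *m P j = 0.
  move=> ij; have [A SA neq] : exists2 A, S A & chi i A != chi j A.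
    apply: contrapT => H; move/eqP: ij; apply; apply: injV; apply/vspaceP => v.
    have E A : S A -> chi i A = chi j A.
      by move=> SA; apply/eqP/negPn/negP => neq; apply: H; exists A.
    by apply/idP/idP => /Hchi vV; apply/Hchi => A SA; rewrite vV// E.
  have : (chi i A - chi j A) *: (P i *m P j) = 0.
    by rewrite scalerBl scalemxAl -PA// scalemxAr -AP// mulmxA subrr.
  by move/eqP; rewrite scaler_eq0 subr_eq0 (negPf neq) => /eqP.
have P0 i : P i != 0.
  have [V0 _] := Vsim i; apply: contra_neq V0 => Pi0; apply/eqP; rewrite -subv0.
  by apply/subvP => w /VP; rewrite Pi0 mul0mx => <-; rewrite mem0v.
have sum1 : \sum_i P i = 1%:M.
  pose Q := 1%:M - \sum_i P i.
  have QP i : Q *m P i = 0.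
    rewrite mulmxBl mul1mx mulmx_suml (bigD1 i)//= PP big1 ?addr0 ?subrr// => j ji.
    exact: orth.
  have [U HU] : exists U : {vspace 'cV[R]_n}, forall w, w \in U <-> Q *m w = w.
    apply: linear_pred_vspace => [|c u w uQ wQ]; first by rewrite mulmx0.
    by rewrite mulmxDr -scalemxAr uQ wQ.
  have QQ : Q *m Q = Q.
    rewrite {2}/Q mulmxBr mulmx1 mulmx_sumr big1 ?subr0// => i _; exact: QP.
  have AQ A : S A -> omx A *m Q = Q *m omx A.
    move=> SA; rewrite mulmxBl mulmxBr mulmx1 mul1mx mulmx_sumr mulmx_suml.
    by congr (_ - _); apply: eq_bigr => i _; rewrite AP// PA.
  have [U0|Un0] := eqVneq U 0%VS.
    apply/eqP; rewrite eq_sym -subr_eq0; apply/eqP/matrixP => p q.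
    have : col q Q \in U by apply/HU; rewrite mulmx_col QQ.
    by rewrite U0 memv0 => /eqP/colP/(_ p); rewrite !mxE.
  have [|u [uU u0] [psi Hpsi]] := @simultaneous_eigenvectors U Un0.
    by move=> A w SA /HU wQ; apply/HU; rewrite mulmxA -AQ// -mulmxA wQ.
  have [W HW] : exists W : {vspace 'cV[R]_n}, forall w, w \in W <->
      forall A, S A -> omx A *m w = psi A *: w.
    apply: linear_pred_vspace => [A SA|c v w vW wW A SA]; first by rewrite mulmx0 scaler0.
    by rewrite mulmxDr -scalemxAr vW// wW// scalerDr !scalerA mulrC.
  have uW : u \in W by apply/HW.
  have [i Vi] : exists i, V i = W.
    apply/enumV; split; last by exists psi.
    by apply: contraNneq u0 => W0; move: uW; rewrite W0 memv0.
  have := uW; rewrite -Vi => /VP Pu; move/HU: uU => Qu.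
  by move/eqP: u0; case; rewrite -Qu -Pu mulmxA QP mul0mx.
exists P; split; [by split|exact: VP|by move=> i; case: (HP i)|].
by move=> i A SA; exists (chi i A); exact: AP.
Qed.
End Eigenprojections.

(** * Conjugating a saturated group *)

Section Linear.
Variables (R : realType) (n : nat).
Implicit Types (G : set 'M[R]_n).

(** G commutes with the involutions of its centre, so it preserves their simultaneous
    eigenspaces. *)
Lemma adapted_eigen G (S : set (orthogonal_matrix R n)) s (V : 'I_s -> {vspace 'cV[R]_n})
    (P : 'I_s -> 'M[R]_n) :
  saturated G -> (forall b, involutive_centre G b <-> exists2 A, omx A = b & S A) ->
  (forall i, sim_eigenspace S (V i)) -> block_decomposition P ->
  (forall i w, w \in V i <-> P i *m w = w) ->
  (forall i A, S A -> exists e : R, omx A *m P i = e *: P i) -> adapted G P.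
Proof.
move=> satG SG simV bdP VP AP; split=> [i|i b /SG[A <- SA]]; last exact: AP.
have [_ [chi Hchi]] := simV i.
have stab g : G g -> g *m P i = P i *m g *m P i.
  move=> Gg; apply/matrixP => p q; rewrite -mulmxA.
  have : P i *m (g *m col q (P i)) = g *m col q (P i).
    apply/VP/Hchi => A SA.
    have [[_ cA] _] : involutive_centre G (omx A) by apply/SG; exists A.
    rewrite mulmxA -(cA g Gg) -mulmxA scalemxAr; congr (_ *m _).
    by apply: (Hchi _).1 SA; apply/VP; rewrite mulmx_col (bd_idem bdP).
  by rewrite !mulmx_col => /colP/(_ p); rewrite !mxE => ->.
move=> g Gg; apply: projection_commutes; [exact: (bd_sym bdP)|exact: stab|].
by apply: stab; exact: sat_tr.
Qed.

Definition conj_mx (A : 'M[R]_n) G : set 'M[R]_n := [set g | G (A *m g *m A^T)].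

Lemma conj_mxM (A g h : 'M[R]_n) : A^T *m A = 1%:M ->
  A *m (g *m h) *m A^T = (A *m g *m A^T) *m (A *m h *m A^T).
Proof. by move=> AA; rewrite !mulmxA -(mulmxA _ A^T A) AA mulmx1. Qed.

Variables (A : 'M[R]_n) (G : set 'M[R]_n).
Hypotheses (AA : A^T *m A = 1%:M) (satG : saturated G).

Let AA' : A *m A^T = 1%:M. Proof. exact: mulmx1C. Qed.

Lemma conj_mx_inj (g h : 'M[R]_n) : A *m g *m A^T = A *m h *m A^T -> g = h.
Proof.
move=> /(congr1 (fun Z => A^T *m Z *m A)).
by rewrite !mulmxA AA !mul1mx -!mulmxA AA !mulmx1.
Qed.

Lemma conj_mxE (g : 'M[R]_n) : A *m (A^T *m g *m A) *m A^T = g.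
Proof. by rewrite !mulmxA AA' mul1mx -mulmxA AA' mulmx1. Qed.

Lemma conj_mx_tr (g : 'M[R]_n) : A *m g^T *m A^T = (A *m g *m A^T)^T.
Proof. by rewrite !trmx_mul trmxK mulmxA. Qed.

Lemma commutant_conj X : commutant (conj_mx A G) X <-> commutant G (A *m X *m A^T).
Proof.
split=> cX g Gg.
  have Hg : conj_mx A G (A^T *m g *m A) by rewrite /conj_mx /mkset conj_mxE.
  by rewrite -[g]conj_mxE -!conj_mxM// (cX _ Hg).
by apply: conj_mx_inj; rewrite !conj_mxM// cX.
Qed.

Lemma centre_conj z : centre (conj_mx A G) z <-> centre G (A *m z *m A^T).
Proof. by rewrite /centre /= commutant_conj. Qed.

Lemma involutive_centre_conj b :
  involutive_centre (conj_mx A G) b <-> involutive_centre G (A *m b *m A^T).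
Proof.
rewrite /involutive_centre /= centre_conj -conj_mxM//; split=> -[? e]; split=> //.
  by rewrite e mulmx1.
by apply: conj_mx_inj; rewrite e mulmx1 AA'.
Qed.

Lemma saturated_conj : saturated (conj_mx A G).
Proof.
split; rewrite /conj_mx /=.
- move=> g /(sat_orth satG) e; apply: conj_mx_inj.
  by rewrite conj_mxM// conj_mx_tr e mulmx1 AA'.
- by rewrite mulmx1 AA'; exact: sat_1.
- by move=> g h Gg Gh; rewrite conj_mxM//; exact: sat_M.
- by move=> g Gg; rewrite conj_mx_tr; exact: sat_tr.
- move=> g h Gg Gh; have [e|e] := sat_comm satG Gg Gh; [left|right];
    apply: conj_mx_inj; rewrite ?mulmxN ?mulNmx !conj_mxM//.
- move=> J Jt cJ JJ c t ct; rewrite !mulmxDr !mulmxDl mulmx1 AA' -!scalemxAr -!scalemxAl conj_mxM//.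
  apply: sat_rot => //; first by rewrite -conj_mx_tr Jt mulmxN mulNmx.
    exact/commutant_conj.
  by rewrite -!conj_mxM// JJ mulmxN mulNmx.
- move=> X Y Xt cX cY; apply: conj_mx_inj; rewrite !conj_mxM//.
  apply: (sat_central satG); [by rewrite -conj_mx_tr Xt mulmxN mulNmx| |]; exact/commutant_conj.
Qed.

Lemma transversal_conj (I : finType) (a : I -> 'M[R]_n) : transversal G a ->
  transversal (conj_mx A G) (fun i => A^T *m a i *m A).
Proof.
move=> tvG; split=> [i|g Gg|i j z cz e].
- by rewrite /conj_mx /mkset conj_mxE; exact: (tv_in tvG).
- have [i [z [cz e]]] := tv_ex tvG Gg; exists i, (A^T *m z *m A); split.
    by apply/centre_conj; rewrite conj_mxE.
  by apply: conj_mx_inj; rewrite conj_mxM// !conj_mxE.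
- move/centre_conj: cz => cz; apply: (tv_uniq tvG cz).
  by rewrite -[LHS]conj_mxE e conj_mxM// conj_mxE.
Qed.

Lemma generating_conj m (x : 'I_m -> 'M[R]_n) : generating G x ->
  generating (conj_mx A G) (fun i => A^T *m x i *m A).
Proof.
move=> gx; split=> [b|H HM Hc Hx g Gg].
  by rewrite /conj_mx /mkset conj_mxE; exact: (gen_in gx).
have := gen_ind gx (H := [set h | H (A^T *m h *m A)]) _ _ _ Gg.
rewrite /= (_ : A^T *m (A *m g *m A^T) *m A = g); last first.
  by apply: conj_mx_inj; rewrite conj_mxE.
apply=> //= [h k Hh Hk|z cz].
  have -> : A^T *m (h *m k) *m A = (A^T *m h *m A) *m (A^T *m k *m A).
    by apply: conj_mx_inj; rewrite [RHS]conj_mxM // !conj_mxE.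
  exact: HM.
by apply: Hc; apply/centre_conj; rewrite conj_mxE.
Qed.
End Linear.

(** * The preimage in O(n) of a closed abelian subgroup *)

Section Preimage.
Variables (R : realType) (n : nat).
Implicit Types (A B : orthogonal_matrix R n) (X Y J : 'M[R]_n).

Definition preimage_mx (F : set (projO R n)) : set 'M[R]_n :=
  [set M | exists2 A, omx A = M & F (piO A)].

Lemma preimage_mxE F A : preimage_mx F (omx A) <-> F (piO A).
Proof.
split=> [[B BA FB]|FA]; last by exists A.
by have <- : B = A by apply: val_inj.
Qed.

Lemma omx_inj A B : omx A = omx B -> A = B.
Proof. by move=> AB; apply: val_inj. Qed.

Lemma preimage_centre F A : centre (preimage_mx F) (omx A) <-> ker_m F (piO A).
Proof.
split=> [[/preimage_mxE FA cA]|[FA kA]].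
  split=> // y Fy; apply/(m1P (erefl _) (piO_repr y))/omx_inj.
  by rewrite !omxM cA//; apply/preimage_mxE; rewrite piO_repr.
split; first exact/preimage_mxE.
move=> _ [B <- FB]; have /(m1P (erefl _) (erefl _)) := kA _ FB.
by move=> /(congr1 (@omx _ _)); rewrite !omxM.
Qed.

Lemma preimage_involutive_centre F b : involutive_centre (preimage_mx F) b <->
  exists2 A, omx A = b & (@piO R n @^-1` BF F) A.
Proof.
split=> [[cb bb]|[A <- [kA sqA]]].
  have [[A Ab FA] _] := cb; exists A => //; split.
    by apply/preimage_centre; rewrite Ab.
  have AA : (A * A)%g = 1%g by apply: omx_inj; rewrite omxM Ab bb.
  by move=> B /piO_eq[]->; rewrite ?mul_oopp ?ooppK.
split; first exact/preimage_centre.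
by rewrite -omxM sqA.
Qed.

Hypothesis n_gt0 : (0 < n)%N.

Lemma expmx_freq_comm (c : R) X Y :
  (forall e, 0 < e -> exists2 t, 0 < t < e & Y *m expmx (t *: X) = c *: (expmx (t *: X) *m Y)) ->
  Y = c *: Y /\ Y *m X = c *: (X *m Y).
Proof.
move=> H.
pose psi : {linear 'M[R]_n -> 'M[R]_n} := mulmx Y \- c \*: mulmxr Y.
have [|] := @expmx_freq_linear R n psi X.
  by move=> e /H[t te tE]; exists t => //; rewrite /psi /= tE subrr.
rewrite /psi /= mulmx1 mul1mx => /eqP; rewrite subr_eq0 => /eqP Yc /eqP.
by rewrite subr_eq0 => /eqP.
Qed.

(** For A over F, the matrices A exp (t X) and exp (t X) A agree up to a sign.  The
    sign -1 cannot occur for arbitrarily small t, as t -> 0 would give A = - A;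
    hence the sign is 1 for small t, and A commutes with X. *)
Lemma lie_sub_fixed (F : closed_abelian R n) X : lie F X -> lie_fixed F X.
Proof.
move=> [Xt HX]; split=> // A FA.
suff e : omx A *m X = X *m omx A.
  by rewrite /Ad e omxV -mulmxA omulmxT mulmx1.
have AE t : omx A *m expmx (t *: X) = expmx (t *: X) *m omx A \/
    omx A *m expmx (t *: X) = (-1) *: (expmx (t *: X) *m omx A).
  have [E <- FE] := HX t; have := commP (erefl _) (erefl _) (ca_C FA FE).
  by case=> /(congr1 (@omx _ _)); rewrite ?omxM => ->; [left|right; rewrite scaleN1r].
have [H|/existsNP[e /not_implyP[e0 H]]] := pselect (forall e, 0 < e -> exists2 t, 0 < t < e &
    omx A *m expmx (t *: X) = 1 *: (expmx (t *: X) *m omx A)).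
  by have [_] := expmx_freq_comm H; rewrite scale1r.
have H2 e' : 0 < e' -> exists2 t, 0 < t < e' &
    omx A *m expmx (t *: X) = (-1) *: (expmx (t *: X) *m omx A).
  move=> e'0; exists (Num.min e e' / 2).
    have m0 : 0 < Num.min e e' by rewrite lt_min e0.
    rewrite divr_gt0//=; apply: lt_le_trans (_ : Num.min e e' <= _).
      by rewrite ltr_pdivrMr// ltr_pMr// ltr1n.
    by rewrite ge_min lexx orbT.
  have [c|//] := AE (Num.min e e' / 2); exfalso; apply: H; exists (Num.min e e' / 2).
    have m0 : 0 < Num.min e e' by rewrite lt_min e0.
    rewrite divr_gt0//=; apply: lt_le_trans (_ : Num.min e e' <= _).
      by rewrite ltr_pdivrMr// ltr_pMr// ltr1n.
    by rewrite ge_min lexx.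
  by rewrite scale1r.
have [/eqP+ _] := expmx_freq_comm H2.
rewrite scaleN1r -addr_eq0 -mulr2n -scaler_nat scaler_eq0 pnatr_eq0 /= => /eqP A0.
have := omulmxT A; rewrite A0 mul0mx => /matrixP/(_ (Ordinal n_gt0) (Ordinal n_gt0)).
by rewrite !mxE eqxx => /esym/eqP; rewrite oner_eq0.
Qed.

Variable F : closed_abelian R n.
Hypothesis dimF : exists d, subspace_dim (lie_fixed F) d /\ subspace_dim (lie F) d.

(** An inclusion of subspaces of the same finite dimension is an equality. *)
Lemma lie_fixed_eq X : lie_fixed F X <-> lie F X.
Proof.
split; last exact: lie_sub_fixed.
have [d [[U [HU dU]] [W [HW dW]]]] := dimF.
have WU : (W <= U)%VS by apply/subvP => Y /HW/lie_sub_fixed/HU.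
have /eqP WE : W == U by rewrite eqEdim WU dU dW leqnn.
by move=> /HU; rewrite -WE => /HW.
Qed.

Lemma preimage_so_commutant X : X^T = - X -> commutant (preimage_mx F) X -> lie F X.
Proof.
move=> Xt cX; apply/lie_fixed_eq; split=> // A FA.
by rewrite /Ad cX ?omxV; [rewrite -mulmxA omulmxT mulmx1|exact/preimage_mxE].
Qed.

Lemma unit_circle_cos_sin (c t : R) : c ^+ 2 + t ^+ 2 = 1 ->
  exists2 r, cos r = c & sin r = t.
Proof.
move=> ct; have c1 : -1 <= c <= 1 by have := sqr_ge0 t; move=> t2; apply/andP; split; nra.
have ca : cos (acos c) = c by rewrite acosK.
have sa : sin (acos c) = Num.sqrt (t ^+ 2).
  by rewrite sin_acos//; congr Num.sqrt; rewrite -ct addrC addKr.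
rewrite sqrtr_sqr in sa; have [t0|t0] := leP 0 t.
  by exists (acos c); rewrite ?ca// sa ger0_norm.
by exists (- acos c); rewrite ?cosN// sinN sa ltr0_norm// opprK.
Qed.

Lemma saturated_preimage : saturated (preimage_mx F).
Proof.
split.
- by move=> _ [A <- _]; exact: omulmxT.
- by exists 1%g => //; rewrite piO1; exact: ca_1.
- move=> _ _ [A <- FA] [B <- FB]; exists (A * B)%g => //.
  by rewrite piOM; exact: ca_M.
- by move=> _ [A <- FA]; exists A^-1%g => //; rewrite piOV; exact: ca_V.
- move=> _ _ [A <- FA] [B <- FB].
  by have [] := commP (erefl _) (erefl _) (ca_C FA FB) => /(congr1 (@omx _ _)); [left|right].
- move=> J Jt cJ JJ c t /unit_circle_cos_sin[r <- <-].
  have [_ /(_ r)[A]] := preimage_so_commutant Jt cJ.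
  by rewrite expmx_tripotent// => AE FA; exists A.
- move=> X Y Xt cX cY; have [_ HX] := preimage_so_commutant Xt cX.
  have [|_ ->] := @expmx_freq_comm 1 X Y; last by rewrite scale1r.
  move=> e e0; exists (e / 2); first by apply/andP; split; lra.
  by have [A <- FA] := HX (e / 2); rewrite scale1r cY//; exists A.
Qed.

End Preimage.

(** * Lifting F / ker m to the preimage *)

Section Lifting.
Variables (R : realType) (n : nat) (F : closed_abelian R n).
Implicit Types (A B : orthogonal_matrix R n) (u v : quo F).

Definition lift_quo u : 'M[R]_n := omx (repr (val (quo_repr u))).

Lemma lift_quo_in u : preimage_mx F (lift_quo u).
Proof. by apply/preimage_mxE; rewrite piO_repr; exact: eltP. Qed.

(** ker m is the image of the centre of the preimage. *)
Lemma to_quo_centre A B (FA : ca_set F (piO A)) (FB : ca_set F (piO B)) :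
  to_quo (mkelt FA) = to_quo (mkelt FB) <-> centre (preimage_mx F) (omx A *m (omx B)^T).
Proof.
rewrite -omxV -omxM preimage_centre piOM piOV to_quo_eq.
by split=> [/asboolP|h]; last apply/asboolP.
Qed.

Lemma lift_quo_centre A (FA : ca_set F (piO A)) u : to_quo (mkelt FA) = u <->
  centre (preimage_mx F) (omx A *m (lift_quo u)^T).
Proof.
have Fu : ca_set F (piO (repr (val (quo_repr u)))) by rewrite piO_repr; exact: eltP.
rewrite -(to_quo_centre FA Fu).
suff -> : mkelt Fu = quo_repr u by rewrite quo_reprK.
by apply: val_inj; rewrite /= piO_repr.
Qed.

Lemma mbar_comm u v : mbar u v = 1 <-> lift_quo u *m lift_quo v = lift_quo v *m lift_quo u.
Proof.
rewrite /mbar (m1P (piO_repr _) (piO_repr _)); split=> [/(congr1 (@omx _ _))|e].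
  by rewrite !omxM.
by apply: omx_inj; rewrite !omxM.
Qed.

Variables (I : finType) (g : I -> quo F).

Lemma transversal_lift : bijective g -> transversal (preimage_mx F) (lift_quo \o g).
Proof.
move=> [h hK gK]; split=> [i|_ [A <- FA]|i j z cz e] /=.
- exact: lift_quo_in.
- exists (h (to_quo (mkelt FA))), (omx A *m (lift_quo (to_quo (mkelt FA)))^T).
  rewrite gK; split; first exact/lift_quo_centre.
  by rewrite -mulmxA otrmxM mulmx1.
- have Fr (w : quo F) : ca_set F (piO (repr (val (quo_repr w)))).
    by rewrite piO_repr; exact: eltP.
  have mkE (w : quo F) : to_quo (mkelt (Fr w)) = w.
    by rewrite -[RHS]quo_reprK; congr to_quo; apply: val_inj; rewrite /= piO_repr.
  apply: (can_inj hK); rewrite -[g i]mkE -[g j]mkE; apply/to_quo_centre.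
  by move: e; rewrite /= -!/(lift_quo _) => ->; rewrite -mulmxA omulmxT mulmx1.
Qed.
End Lifting.

Section Generators.
Variables (R : realType) (n k : nat) (F : closed_abelian R n).
Variable g : 'rV['F_2]_k -> quo F.
Hypotheses (gD : forall u v, g (u + v) = g u + g v) (gbij : bijective g).
Hypothesis satF : saturated (preimage_mx F).

Definition basis_lift (b : 'I_k) : 'M[R]_n := lift_quo (g (delta_mx 0 b)).

Lemma generating_lift : generating (preimage_mx F) basis_lift.
Proof.
split=> [b|H HM Hc Hx]; first exact: lift_quo_in.
pose Hq (u : 'rV['F_2]_k) := forall A (FA : ca_set F (piO A)), to_quo (mkelt FA) = g u -> H (omx A).
have HqD u v : Hq u -> Hq v -> Hq (u + v).
  move=> Hu Hv A FA Au.
  have [B BE FB] := lift_quo_in (g u).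
  have Bu : to_quo (mkelt FB) = g u.
    by apply/lift_quo_centre; rewrite BE omulmxT; exact: centre1.
  have FAB : ca_set F (piO (A * B^-1)%g).
    by rewrite piOM piOV; apply: ca_M => //; exact: ca_V.
  have : H (omx (A * B^-1)%g *m omx B).
    apply: HM; last exact: Hu Bu.
    apply: (Hv _ FAB); apply: (addIr (g u)); rewrite -{1}Bu -to_quoD.
    have -> : mkelt FAB + mkelt FB = mkelt FA.
      by apply: val_inj; rewrite /= -piOM mulgVK.
    by rewrite Au gD addrC.
  by rewrite omxM omxV -mulmxA otrmxM mulmx1.
have g0 : g 0 = 0 by apply: (addrI (g 0)); rewrite -gD !addr0.
have Hq0 : Hq 0.
  move=> A FA; rewrite g0 -to_quo0 => /to_quo_eq; rewrite subr0 => /asboolP kA.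
  by apply: Hc; apply/preimage_centre.
have Hqb b : Hq (delta_mx 0 b).
  move=> A FA /lift_quo_centre cA.
  have -> : omx A = (omx A *m (basis_lift b)^T) *m basis_lift b.
    by rewrite -mulmxA otrmxM mulmx1.
  by apply: HM => //; exact: Hc.
have Hall u : Hq u.
  rewrite [u]row_sum_delta; apply: (big_ind Hq) => // b _.
  rewrite -[u 0 b]natr_Zp scaler_nat; elim: (nat_of_ord (u 0 b)) => [|j IH].
    by rewrite mulr0n.
  by rewrite mulrS; exact: HqD.
move=> _ [A <- FA]; have [h hK gK] := gbij.
by apply: (Hall (h (to_quo (mkelt FA))) _ FA); rewrite gK.
Qed.
End Generators.

(** * The conjugacy theorem *)

Section Transport.
Variables (R : realType) (n : nat).

Lemma involutive_centre_transport (F F' : set (projO R n)) (A : orthogonal_matrix R n) :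
  conjs (piO A) (BF F) = BF F' ->
  forall b, involutive_centre (preimage_mx F) b <->
            involutive_centre (conj_mx (omx A) (preimage_mx F')) b.
Proof.
move=> BFE b; rewrite involutive_centre_conj ?otrmxM// !preimage_involutive_centre.
split=> -[B BE BB].
  exists (A * B * A^-1)%g; first by rewrite !omxM BE omxV.
  by rewrite /preimage /= -BFE; exists (piO B) => //; rewrite !piOM piOV.
move: BB; rewrite /preimage /= -BFE => -[y By yE].
exists (A^-1 * B * A)%g.
  by rewrite !omxM BE omxV !mulmxA otrmxM mul1mx -mulmxA otrmxM mulmx1.
by rewrite !piOM piOV -yE !mulgA mulVg mul1g mulgVK.
Qed.

Lemma commute_alike_conj m (A : 'M[R]_n) (G G' : set 'M[R]_n) (x x' : 'I_m -> 'M[R]_n) :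
  A *m A^T = 1%:M -> saturated G -> saturated G' ->
  (forall b, G (x b)) -> (forall b, G' (x' b)) ->
  (forall b c, x b *m x c = x c *m x b <-> x' b *m x' c = x' c *m x' b) ->
  commute_alike x (fun b => A^T *m x' b *m A).
Proof.
move=> AA satG satG' Gx Gx' xx b c.
have E u v : (A^T *m x' u *m A) *m (A^T *m x' v *m A) = A^T *m (x' u *m x' v) *m A.
  by rewrite !mulmxA -(mulmxA _ A A^T) AA mulmx1.
rewrite !E.
have [e|e] := sat_comm satG (Gx b) (Gx c).
  by left; split=> //; rewrite (xx b c).1.
have [e'|e'] := sat_comm satG' (Gx' b) (Gx' c); last first.
  by right; split=> //; rewrite e' mulmxN mulNmx.
by left; rewrite e' (xx b c).2.
Qed.

Lemma mu_lift (V : {vspace 'cV[R]_n}) (F : closed_abelian R n) (u : quo F) (e : R) :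
  V != 0%VS -> e = 1 \/ e = -1 ->
  (forall v, v \in V -> lift_quo u *m lift_quo u *m v = e *: v) ->
  mu V (val (quo_repr u)) = e.
Proof.
move=> V0 e1 sq; apply: (muE V0 e1 (piO_repr _)) => v /sq.
by rewrite -mulmxA.
Qed.
End Transport.

Theorem proposition3p2 (R : realType) (n : nat) (n_gt0 : (0 < n)%N)
    (F F' : closed_abelian R n)
    (dimF : exists d, subspace_dim (lie_fixed F) d /\ subspace_dim (lie F) d)
    (dimF' : exists d, subspace_dim (lie_fixed F') d /\ subspace_dim (lie F') d)
    (k k' : nat)
    (rankF : lmod_dim (quo F) (2 * k)%N) (rankF' : lmod_dim (quo F') (2 * k')%N)
    (D : eigen_ordering F k) (D' : eigen_ordering F' k')
    (eq_k : k = k')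
    (A : orthogonal_matrix R n) (conj_BF : conjs (piO A) (BF F) = BF F')
    (sigma : 'I_(eo_s0 D) -> 'I_(eo_s0 D'))
    (match_eigenspaces : forall i, omove A (eo_W i) = eo_W (sigma i))
    (iso_linear_structure :
      @mm_iso_along _ (linear_structure D) (linear_structure D') sigma) :
  exists g : projO R n, conjs g F = F'.
Proof.
have [_ [phi [phi_bij phi_form phi_quad]]] := iso_linear_structure.
have [f [h fK hK]] := rankF.
have hD u v : h (u + v) = h u + h v by apply: (can_inj fK); rewrite linearD !hK.
have h_bij : bijective h by exists f.
(* the basis of F' / ker m is the image under phi of that of F / ker m *)
pose h' u : quo F' := phi (h u).
have hD' u v : h' (u + v) = h' u + h' v by rewrite /h' hD linearD.
have h_bij' : bijective h' by exact: (bij_comp phi_bij h_bij).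
have satF := saturated_preimage n_gt0 dimF.
have satF' := saturated_preimage n_gt0 dimF'.
have AA := otrmxM A; have AA' := omulmxT A.
have satG' := saturated_conj AA satF'.
(* the preimage of F' is conjugated back by A, to get the same involutive centre *)
set G := preimage_mx F in satF; set G' := conj_mx (omx A) (preimage_mx F') in satG'.
have BB' : forall b, involutive_centre G b <-> involutive_centre G' b.
  exact: involutive_centre_transport.
have SG := preimage_involutive_centre (F : set (projO R n)).
have invS B : (@piO R n @^-1` BF F) B -> omx B *m omx B = 1%:M.
  by move=> SB; have [_] : involutive_centre G (omx B) by apply/SG; exists B.
have comS B C : (@piO R n @^-1` BF F) B -> (@piO R n @^-1` BF F) C ->
    omx B *m omx C = omx C *m omx B.
  move=> SB SC; have [[GB _] _] : involutive_centre G (omx B) by apply/SG; exists B.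
  have [[_ cC] _] : involutive_centre G (omx C) by apply/SG; exists C.
  exact: cC.
have [P [bdP VP trP AP]] := eigenprojections invS comS (@eo_inj _ _ _ _ D) (@eo_enum _ _ _ _ D).
have simV i : sim_eigenspace (@piO R n @^-1` BF F) (eo_V (e := D) i).
  by apply/eo_enum; exists i.
have adP : adapted G P := adapted_eigen satF SG simV bdP VP AP.
have adP' : adapted G' P.
  apply: (adapted_eigen satG' _ simV bdP VP AP) => b.
  by rewrite -BB'.
have tvG := transversal_lift h_bij.
have tvG' := transversal_conj AA (transversal_lift h_bij').
have gx := generating_lift hD h_bij satF.
have gx' := generating_conj AA (generating_lift hD' h_bij' satF').
have xx : commute_alike (basis_lift h) (fun b => (omx A)^T *m basis_lift h' b *m omx A).
  apply: (commute_alike_conj AA' satF satF'); [exact: (gen_in gx)|by move=> b; exact: lift_quo_in|].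
  move=> b c; rewrite /basis_lift -!mbar_comm.
  by have := phi_form (h (delta_mx 0 b)) (h (delta_mx 0 c)); rewrite /= => ->.
have cardI : #|{: 'rV['F_2]_(2 * k)}| = (2 ^ (2 * k))%N.
  by rewrite card_mx card_Fp// mul1n.
have sepx := separating_of_card satF tvG gx cardI.
have [|V VV GV] := conj_of_matching bdP satF satG' adP adP' tvG tvG' gx gx' xx sepx BB'.
  move=> i; rewrite trP cardI -natrX => /eqP; rewrite eqr_nat => /eqP dimVi b e e' e1 e1' sq sq'.
  (* a block beyond s0 has dimension 2 ^ k.+1, whose square is not 4 ^ k *)
  have lt_is : (i < eo_s0 D)%N.
    rewrite ltnNge; apply/negP => /(@eo_dim2 _ _ _ _ D) di; move: dimVi.
    rewrite di -expnM => /(expnI (ltnSn 1)); rewrite mulnC => /eqP.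
    by rewrite eqn_mul2l /= eqn_leq ltnn.
  pose i0 : 'I_(eo_s0 D) := Ordinal lt_is.
  have Wi : eo_W i0 = eo_V (e := D) i by congr eo_V; exact: val_inj.
  have muF : mu (eo_W i0) (val (quo_repr (h (delta_mx 0 b)))) = e.
    apply: mu_lift => //; first by rewrite Wi; case: (simV i).
    move=> v; rewrite Wi => /VP <-; rewrite [LHS]mulmxA sq -scalemxAl //.
  have muF' : mu (eo_W (sigma i0)) (val (quo_repr (h' (delta_mx 0 b)))) = e'.
    have AW v : v \in eo_W (sigma i0) -> exists2 w, P i *m w = w & v = omx A *m w.
      rewrite -match_eigenspaces /omove Wi => /memv_imgP[w /VP wP ->].
      by exists w => //; rewrite lfunE.
    apply: mu_lift => //.
      have [V0 _] := simV i; apply: contra_neq V0 => W0.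
      apply/eqP; rewrite -subv0; apply/subvP => w wV.
      have : omx A *m w \in eo_W (sigma i0).
        by rewrite -match_eigenspaces /omove Wi; apply/memv_imgP; exists w; rewrite ?lfunE.
      rewrite W0 !memv0 => /eqP Aw.
      by rewrite -[w]mul1mx -AA -mulmxA Aw mulmx0.
    move=> v /AW[w wP ->].
    have : omx A *m ((omx A)^T *m basis_lift h' b *m omx A *m
      ((omx A)^T *m basis_lift h' b *m omx A) *m P i) *m w = omx A *m (e' *: P i) *m w.
      by rewrite sq'.
    rewrite -scalemxAr -scalemxAl -!mulmxA wP => <-.
    by rewrite !mulmxA AA' mul1mx -(mulmxA _ _ (omx A)^T) AA' mulmx1.
  rewrite -muF -muF'; apply/esym; exact: (phi_quad i0).
have AVorth : (omx A *m V) *m (omx A *m V)^T == 1%:M.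
  by rewrite trmx_mul !mulmxA -(mulmxA _ V) VV mulmx1 AA'.
pose W := OrthogonalMatrix AVorth.
have FW B : ca_set F (piO B) <-> ca_set F' (piO (W * B * W^-1)%g).
  apply: (iff_trans (iff_sym (preimage_mxE F B))); apply: (iff_trans (GV _)).
  apply: (iff_trans _ (preimage_mxE F' _)).
  by rewrite /G' /conj_mx /mkset !omxM omxV /= trmx_mul !mulmxA.
exists (piO W); apply/seteqP; split=> [_ [y Fy <-]|y Fy].
  rewrite -[y]piO_repr -piOV -!piOM; apply/FW; rewrite piO_repr //.
exists (piO (W^-1 * repr y * W)%g).
  by apply/FW; rewrite !mulgA mulgV mul1g mulgK piO_repr.
by rewrite -piOV -!piOM !mulgA mulgV mul1g mulgK piO_repr.
Qed.
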